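(* Let $\mathscr{M}=(\mathsf{M},\tau,\mathfrak{m})$ and $\mathscr{M}'=(\mathsf{M}',\tau',\mathfrak{m}')$ be normalized bounded Lorentzian metric measure spaces. The following are equivalent. (i) $\mathscr{M}$ and $\mathscr{M}'$ are isomorphic. (ii) There exists a coupling $\pi$ of $\mathfrak{m}$ and $\mathfrak{m}'$ such that $\tau(x,y)=\tau'(x',y')$ for $\pi^{\otimes2}$-a.e. $(x,x',y,y')\in(\mathsf{M}\times\mathsf{M}')^2$. (iii) There exist a normalized bounded Lorentzian metric measure space $\hat{\mathscr{M}}=(\hat{\mathsf{M}},\hat\tau,\hat{\mathfrak{m}})$ with spacelike boundary $\hat\imath^0$ and $\mathrm{spt}\,\hat{\mathfrak{m}}\cup\{\hat\imath^0\}=\hat{\mathsf{M}}$ as well as distance-preserving maps $\hat\iota\colon\hat{\mathsf{M}}\to\mathrm{spt}\,q_\sharp\mathfrak{m}\cup\{i^0\}$ and $\hat\iota'\colon\hat{\mathsf{M}}\to\mathrm{spt}\,q'_\sharp\mathfrak{m}'\cup\{i'^0\}$ with $\hat\iota_\sharp\hat{\mathfrak{m}}=q_\sharp\mathfrak{m}$ and $\hat\iota'_\sharp\hat{\mathfrak{m}}=q'_\sharp\mathfrak{m}'$.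
   Context: A bounded Lorentzian metric space is a pair $(\mathsf{M},\tau)$ of a nonempty set $\mathsf{M}$ and a function $\tau\colon\mathsf{M}^2\to[0,\infty)$ such that: (a) $\tau(x,y)+\tau(y,z)\le\tau(x,z)$ whenever $\tau(x,y)>0$ and $\tau(y,z)>0$; (b) there is a topology $T$ on $\mathsf{M}$ such that $\tau$ is continuous for the product topology $T^2$ and $\{\tau\ge\varepsilon\}\subset\mathsf{M}^2$ is compact for every $\varepsilon>0$; (c) for all distinct $x,y\in\mathsf{M}$ there is $z\in\mathsf{M}$ with $\tau(x,z)\ne\tau(y,z)$ or $\tau(z,x)\neq\tau(z,y)$. All topological and Borel notions on $\mathsf{M}$ refer to the coarsest topology satisfying (b), which exists and is Polish. A normalized bounded Lorentzian metric measure space is a triple $\mathscr{M}=(\mathsf{M},\tau,\mathfrak{m})$ with $(\mathsf{M},\tau)$ a bounded Lorentzian metric space and $\mathfrak{m}$ a Borel probability measure on $\mathsf{M}$ (not necessarily of full support). A coupling of $\mathfrak{m}$ and $\mathfrak{m}'$ is a Borel probability measure on $\mathsf{M}\times\mathsf{M}'$ with marginals $\mathfrak{m}$ and $\mathfrak{m}'$. A map $\iota$ between bounded Lorentzian metric spaces is distance-preserving if it preserves the time separation functions, i.e. the function $\tau$ of the source at $(x,y)$ equals that of the target at $(\iota(x),\iota(y))$ for all $x,y$. Isomorphy. The spacelike boundary $i^0$ of a bounded Lorentzian metric space is the (unique, if it exists) point with $\tau(i^0,x)=\tau(x,i^0)=0$ for every $x$. On $\mathrm{spt}\,\mathfrak{m}$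 define $x\sim y$ if $\tau(x,z)=\tau(y,z)$ and $\tau(z,x)=\tau(z,y)$ for every $z\in\mathrm{spt}\,\mathfrak{m}$. Let $q\colon\mathrm{spt}\,\mathfrak{m}\to\tilde{\mathsf{M}}$ be the quotient projection and $\tilde\tau(q(x),q(y)):=\tau(x,y)$; then $(\tilde{\mathsf{M}},\tilde\tau)$ is a bounded Lorentzian metric space (the distance quotient), and $\mathrm{spt}\,q_\sharp\mathfrak{m}=\tilde{\mathsf{M}}$, where $\sharp$ denotes push-forward. Write $\mathrm{spt}\,q_\sharp\mathfrak{m}\cup\{i^0\}$ for this space itself if it already has a spacelike boundary, and otherwise for the bounded Lorentzian metric space obtained by adjoining an abstract point $i^0$ (of zero measure) and extending $\tilde\tau$ by zero to pairs involving $i^0$. Use primes for the analogous objects of $\mathscr{M}'$. $\mathscr{M}$ and $\mathscr{M}'$ are isomorphic if there is a distance-preserving Borel measurable map $\iota\colon\mathrm{spt}\,q_\sharp\mathfrak{m}\cup\{i^0\}\to\mathrm{spt}\,q'_\sharp\mathfrak{m}'\cup\{i'^0\}$ with $\iota_\sharp(q_\sharp\mathfrak{m})=q'_\sharp\mathfrak{m}'$. *)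

(* Defs.v *)
From HB Require Import structures.
From mathcomp Require Import all_boot all_order all_algebra generic_quotient.
From mathcomp Require Import all_classical all_reals all_analysis.

Set Implicit Arguments.
Unset Strict Implicit.
Unset Printing Implicit Defensive.

Import Order.TTheory GRing.Theory Num.Theory.
Import numFieldNormedType.Exports.

Local Open Scope classical_set_scope.
Local Open Scope ring_scope.
Local Open Scope quotient_scope.

Record topology (X : Type) := Topology {
  opens : set (set X);
  opensT : opens setT;
  opensI : setI_closed opens;
  opens_bigU : forall (I : Type) (f : I -> set X),
    (forall i, opens (f i)) -> opens (\bigcup_i f i) }.

Definition top_space (X : pointedType) (T : topology X) : Type := X.

HB.instance Definition _ (X : pointedType) (T : topology X) :=
  Pointed.on (top_space T).

HB.instance Definition _ (X : pointedType) (T : topology X) :=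
  isOpenTopological.Build (top_space T)
    (opensT T) (@opensI X T) (@opens_bigU X T).

(* The nonempty underlying sets are modelled by pointed types; the
   distinguished point plays no role. *)
Section BoundedLorentzianMetricSpace.
Context (R : realType) (X : pointedType) (tau : X -> X -> R).

Definition tau_topology (T : topology X) : Prop :=
  continuous (fun p : top_space T * top_space T => tau p.1 p.2) /\
  (forall e : R, 0 < e ->
    compact [set p : top_space T * top_space T | e <= tau p.1 p.2]).

Record is_blms : Prop := IsBLMS {
  blms_ge0 : forall x y, 0 <= tau x y;
  blms_reverse_triangle : forall x y z,
    0 < tau x y -> 0 < tau y z -> tau x y + tau y z <= tau x z;
  blms_topology : exists T : topology X, tau_topology T;
  blms_separation : forall x y : X, x <> y ->
    exists z, tau x z <> tau y z \/ tau z x <> tau z y }.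

Let coarsest_opens : set (set X) :=
  [set U | forall T, tau_topology T -> opens T U].

Let coarsest_opensT : coarsest_opens setT.
Proof. by move=> T _; exact: opensT. Qed.

Let coarsest_opensI : setI_closed coarsest_opens.
Proof. by move=> U V hU hV T hT; apply: opensI; [exact: hU|exact: hV]. Qed.

Let coarsest_opens_bigU (I : Type) (f : I -> set X) :
  (forall i, coarsest_opens (f i)) -> coarsest_opens (\bigcup_i f i).
Proof. by move=> hf T hT; apply: opens_bigU => i; exact: hf. Qed.

(* The intersection of all topologies satisfying [tau_topology]: it is the
   coarsest such topology as soon as a coarsest one exists. *)
Definition coarsest_topology : topology X :=
  Topology coarsest_opensT coarsest_opensI coarsest_opens_bigU.

End BoundedLorentzianMetricSpace.

Notation lspace tau := (top_space (coarsest_topology tau)).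

Definition is_spacelike_boundary (R : realType) (X : Type)
    (tau : X -> X -> R) (i : X) : Prop :=
  forall x, tau i x = 0 /\ tau x i = 0.

Definition distance_preserving (R : realType) (X Y : Type)
    (tau : X -> X -> R) (tau' : Y -> Y -> R) (f : X -> Y) : Prop :=
  forall x y, tau x y = tau' (f x) (f y).

Notation borel T := (g_sigma_algebraType (@open T)).

(* Normalized bounded Lorentzian metric measure spaces. *)
Record nblmms (R : realType) := NBLMMS {
  pt :> pointedType;
  tsep : pt -> pt -> R;
  tsepP : is_blms tsep;
  meas : probability (borel (lspace tsep)) R }.
Arguments tsep {R} n _ _.
Arguments meas {R} n.

Notation tspace M := (lspace (tsep M)).

Definition spt (R : realType) (M : nblmms R) : set (tspace M) :=
  [set x | forall U : set (tspace M), open U -> U x -> (0 < meas M U)%E].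
Arguments spt {R} M _.

Section DistanceQuotient.
Context (R : realType) (M : nblmms R).

Definition indist (x y : spt M) : bool :=
  `[< forall z : spt M, tsep M (val x) (val z) = tsep M (val y) (val z) /\
                        tsep M (val z) (val x) = tsep M (val z) (val y) >].

Let indist_refl : reflexive indist.
Proof. by move=> x; apply/asboolP. Qed.

Let indist_sym : symmetric indist.
Proof.
by move=> x y; apply/asboolP/asboolP => h z; have [-> ->] := h z.
Qed.

Let indist_trans : transitive indist.
Proof.
move=> y x z /asboolP hxy /asboolP hyz; apply/asboolP => w.
by have [-> ->] := hxy w.
Qed.

Canonical indist_equiv := EquivRel indist indist_refl indist_sym indist_trans.

Definition dquot : Type := {eq_quot indist_equiv}.
HB.instance Definition _ := Choice.on dquot.

Definition qproj (x : spt M) : dquot := \pi_({eq_quot indist_equiv}) x.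

Definition qtsep (a b : dquot) : R :=
  tsep M (val (repr (a : {eq_quot indist_equiv})))
       (val (repr (b : {eq_quot indist_equiv}))).

Lemma qtsepE (x y : spt M) : qtsep (qproj x) (qproj y) = tsep M (val x) (val y).
Proof.
have h (z : spt M) : indist (repr (qproj z : {eq_quot indist_equiv})) z.
  by apply/(eqquotP {eq_quot indist_equiv}); rewrite reprK.
rewrite /qtsep; have /asboolP hx := h x; have /asboolP hy := h y.
by rewrite (hx _).1 (hy x).2.
Qed.

End DistanceQuotient.
Arguments qtsep {R} M _ _.

(* The space obtained by adjoining an abstract point [None] with vanishing
   time separations, unless a spacelike boundary is already present. *)
Section AdjoinBoundary.
Context (R : realType) (X : choiceType) (tau : X -> X -> R).

Let has_boundary : Prop := exists i, is_spacelike_boundary tau i.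

Definition with_i0 : Type :=
  [set o : option X | o = None -> ~ has_boundary].

HB.instance Definition _ := Choice.on with_i0.

Lemma with_i0_some (x : X) :
  Some x \in [set o : option X | o = None -> ~ has_boundary].
Proof. by rewrite inE. Qed.

Definition to_with_i0 (x : X) : with_i0 := exist _ (Some x) (with_i0_some x).

Definition tau_i0 (a b : with_i0) : R :=
  match val a, val b with Some x, Some y => tau x y | _, _ => 0 end.

Lemma with_i0_inhabited : $| with_i0 |.
Proof.
have [[i _]|h] := pselect has_boundary; first exact: squash (to_with_i0 i).
by apply: squash; exists None; rewrite inE.
Qed.

HB.instance Definition _ := isPointed.Build with_i0 (unsquash with_i0_inhabited).

End AdjoinBoundary.

Section QuotientWithBoundary.
Context (R : realType) (M : nblmms R).

Definition qi0 : Type := with_i0 (qtsep M).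
HB.instance Definition _ := Pointed.on qi0.

Definition qi0_tsep : qi0 -> qi0 -> R := tau_i0 (tau := qtsep M).

(* The push-forward of the measure of M under qproj, viewed on qi0; the
   measure of M lives on spt M, and an adjoined point has measure zero. *)
Definition qi0_meas (A : set (borel (lspace qi0_tsep))) : \bar R :=
  meas M [set val x | x in
    (fun x : spt M => to_with_i0 (qtsep M) (qproj x)) @^-1` A].

End QuotientWithBoundary.
Arguments qi0_tsep {R} M _ _.
Arguments qi0_meas {R} M _.

Notation qi0_space M := (lspace (qi0_tsep M)).

Definition isomorphic (R : realType) (M M' : nblmms R) : Prop :=
  exists iota : borel (qi0_space M) -> borel (qi0_space M'),
    [/\ distance_preserving (qi0_tsep M) (qi0_tsep M') iota,
        measurable_fun setT iota &
        forall A, measurable A ->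
          pushforward (qi0_meas M) iota A = qi0_meas M' A].

Definition is_coupling (R : realType) (M M' : nblmms R)
    (pi : probability (borel (tspace M * tspace M')%type) R) : Prop :=
  (forall A : set (borel (tspace M)), measurable A ->
     pushforward pi (fst : _ -> borel (tspace M)) A = meas M A) /\
  (forall A : set (borel (tspace M')), measurable A ->
     pushforward pi (snd : _ -> borel (tspace M')) A = meas M' A).

(* Main.v *)
(** The coarsest admissible topology of a bounded Lorentzian metric space is
    generated by countably many time separation functions; it is Hausdorff,
    regular, second countable and sigma-compact, so that finite Borel measures
    are inner regular for compact sets.  A distance-preserving correspondence
    between two such spaces with dense projections reaches every point except
    possibly the spacelike boundary: close to any other point some time
    separation is bounded below, which confines the correspondence to a compact
    set.  Hence a common extension as in (iii), or the support of a coupling as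
    in (ii), is the graph of an isomorphism of the quotients.

    Conversely, an isomorphism yields two maps, from [M] and from [M'], into the
    quotient of [M'] with the same image measure.  The couplings that are product
    measures conditionally on the cells of finer and finer finite partitions of
    this quotient converge along an ultrafilter to a finitely additive coupling;
    compact regularity of the marginals makes it countably additive, and it is
    supported on the fibre product of the two maps. *)

Require Import Defs.
From HB Require Import structures.
From mathcomp Require Import all_boot all_order all_algebra.
From mathcomp Require Import finmap generic_quotient.
From mathcomp Require Import all_classical all_reals all_analysis.
From mathcomp Require Import lra.

Set Implicit Arguments.
Unset Strict Implicit.
Unset Printing Implicit Defensive.

Import Order.TTheory GRing.Theory Num.Theory.
Import numFieldNormedType.Exports.

Local Open Scope classical_set_scope.
Local Open Scope ring_scope.
Local Open Scope quotient_scope.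

(** * General topology *)

Definition sigma_compact (T : topologicalType) : Prop :=
  exists2 C : nat -> set T, (forall n, compact (C n)) & \bigcup_n C n = setT.

Lemma setC_nbhs (T : topologicalType) (A : set T) (x : T) :
  closed A -> ~ A x -> nbhs x (~` A).
Proof.
by move=> cA nAx; apply: open_nbhs_nbhs; split=> //; exact: closed_openC.
Qed.

Lemma openX (T U : topologicalType) (A : set T) (B : set U) :
  open A -> open B -> open (A `*` B).
Proof.
move=> oA oB; rewrite (_ : A `*` B = fst @^-1` A `&` snd @^-1` B)//.
by apply: openI; apply: open_comp => // x _; [exact: cvg_fst|exact: cvg_snd].
Qed.

Lemma closedX (T U : topologicalType) (A : set T) (B : set U) :
  closed A -> closed B -> closed (A `*` B).
Proof.
move=> cA cB; rewrite (_ : A `*` B = fst @^-1` A `&` snd @^-1` B)//.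
by apply: closedI; apply: closed_comp => // x _; [exact: cvg_fst|exact: cvg_snd].
Qed.

Lemma cluster_cvg_eq (T U : topologicalType) (F : set_system T) (u : T -> U)
    (x : T) (l : U) :
  hausdorff_space U -> cluster F x -> u @ F --> l -> {for x, continuous u} ->
  l = u x.
Proof.
move=> hU Fx Fl ux; apply: hU => A B nA nB.
by have [z [Az Bz]] := Fx _ _ (Fl A nA) (ux B nB); exists (u z).
Qed.

Lemma closure_continuous_eq (T U : topologicalType) (f g : T -> U) (A : set T)
    (x : T) :
  hausdorff_space U -> {for x, continuous f} -> {for x, continuous g} ->
  {in A, f =1 g} -> closure A x -> f x = g x.
Proof.
move=> hU fx gx fg Ax; apply: hU => B C nB nC.
have nfB : nbhs x (f @^-1` B) := fx B nB.
have [z [Az [Bz Cz]]] := Ax _ (filterI nfB (gx C nC)).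
by exists (f z); split=> //; rewrite fg// inE.
Qed.

Lemma hausdorff_prod (T U : topologicalType) :
  hausdorff_space T -> hausdorff_space U -> hausdorff_space (T * U)%type.
Proof.
move=> hT hU [a b] [c d] ab_cd; congr pair.
- by apply: (cluster_cvg_eq (u := fst) hT ab_cd); exact: cvg_fst.
- by apply: (cluster_cvg_eq (u := snd) hU ab_cd); exact: cvg_snd.
Qed.

Lemma compact_bigcup_open (T : topologicalType) (K : set T) (U : nat -> set T) :
  compact K -> (forall n, open (U n)) -> K `<=` \bigcup_n U n ->
  exists N, K `<=` \big[setU/set0]_(i < N) U i.
Proof.
move=> /compact_near_coveringP cK oU KU.
have [x /KU[n _ Unx]|N _ KN] := cK _ \oo (fun N => \big[setU/set0]_(i < N) U i) _.
  exists (U n, [set N | (n < N)%N]) => /=.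
    by split; [exact: open_nbhs_nbhs|exists n.+1].
  by move=> [y N] /= [Uny nN]; rewrite -bigcup_mkord; exists n.
by exists N; exact: (KN N (leqnn N)).
Qed.

Lemma second_countable_seq (T : topologicalType) : @second_countable T ->
  exists2 B : nat -> set T, (forall n, open (B n)) &
    forall U x, open U -> U x -> exists2 n, B n x & B n `<=` U.
Proof.
move=> [B cB [oB bB]].
have basic U x : open U -> U x -> exists2 V, B V & V x /\ V `<=` U.
  move=> oU Ux; have [V [BV Vx] VU] := bB x U (open_nbhs_nbhs (conj oU Ux)).
  by exists V.
have [B0|[s]] := pfcard_geP cB.
  exists (fun=> set0) => [_|U x oU Ux]; first exact: open0.
  by have [V] := basic U x oU Ux; rewrite B0.
exists s => [n|U x oU Ux]; first by apply: oB; exact: funS.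
have [V BV [Vx VU]] := basic U x oU Ux.
by have [n _ sn] := @surj _ _ _ _ s V BV; exists n; rewrite sn.
Qed.

Lemma second_countable_prod (T U : topologicalType) : @second_countable T ->
  @second_countable U -> @second_countable (T * U)%type.
Proof.
move=> [B cB [oB bB]] [C cC [oC bC]].
exists [set V `*` W | V in B & W in C].
  rewrite image2E; apply: sub_countable; first exact: card_image_le.
  exact: countableX.
split=> [_ [V BV [W CW <-]]|[x y] A [[P Q] /= [nP nQ] PQA]].
  by apply: openX; [exact: oB|exact: oC].
have [V [BV Vx] VP] := bB _ _ nP; have [W [CW Wy] WQ] := bC _ _ nQ.
exists (V `*` W); first by split=> //=; exists V => //; exists W.
by move=> [u v] [/VP ? /WQ ?]; exact: PQA.
Qed.

Lemma second_countable_realType (R : realType) : @second_countable R.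
Proof.
exists (range (fun p : rat * rat => `]ratr p.1, ratr p.2[%classic : set R)).
  by apply: sub_countable; first exact: card_image_le.
split=> [_ [p _ <-]|x A /nbhs_ballP[e /= e0 eA]]; first exact: interval_open.
have [|p] := @rat_in_itvoo R (x - e) x; first by lra.
rewrite in_itv/= => /andP[ep px].
have [|q] := @rat_in_itvoo R x (x + e); first by lra.
rewrite in_itv/= => /andP[xq qe].
exists `]ratr p, ratr q[%classic.
  by split; [exists (p, q)|rewrite /= in_itv/= px].
move=> y /=; rewrite in_itv/= => /andP[py yq]; apply: eA.
by rewrite -ball_normE /= ltr_distlC; lra.
Qed.

Lemma within_continuous_prod (T T' U U' : topologicalType) (A : set T)
    (B : set T') (f : T -> U) (g : T' -> U') :
  {within A, continuous f} -> {within B, continuous g} ->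
  {within A `*` B, continuous (fun p => (f p.1, g p.2))}.
Proof.
move=> cf cg; apply/continuous_subspace_prodP => -[x y] _.
apply: (cvg_pair (G := nbhs (f x)) (H := nbhs (g y))).
  by apply: (cvg_comp _ _ (@cvg_fst (subspace A) (subspace B) _ _ _)); exact: cf.
by apply: (cvg_comp _ _ (@cvg_snd (subspace A) (subspace B) _ _ _)); exact: cg.
Qed.

Lemma compact_image_continuous (P T U : topologicalType) (f : P -> T)
    (g : T -> U) (h : P -> U) (K : set P) :
  hausdorff_space T -> compact K -> {within K, continuous f} -> continuous h ->
  {in K, g \o f =1 h} -> {within f @` K, continuous g}.
Proof.
move=> hT cK cf ch gf; apply/subspace_continuousP => _ [p Kp <-] V.
rewrite nbhsE => -[W [oW Wp] WV].
pose B := f @` (K `&` h @^-1` (~` W)).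
have cB : compact B.
  apply: continuous_compact; first by apply: continuous_subspaceW cf => ? [].
  apply: compact_closedI => //; apply: closed_comp => [? _|]; first exact: ch.
  exact: open_closedC.
have nBp : ~ B (f p).
  by move=> [q [Kq hq] qp]; apply: hq; rewrite -gf ?inE//= qp.
apply: filterS (setC_nbhs (compact_closed hT cB) nBp) => z + [q Kq qz].
rewrite -{z}qz => nB; apply: WV; apply: contrapT => nW; apply: nB.
by exists q => //; split=> //=; rewrite -gf ?inE.
Qed.

Definition interchange (A B C D : Type) (q : (A * B) * (C * D)) :
  (A * C) * (B * D) := ((q.1.1, q.2.1), (q.1.2, q.2.2)).

Lemma interchange_continuous (A B C D : topologicalType) :
  continuous (@interchange A B C D).
Proof.
move=> q; apply: (cvg_pair (G := nbhs (q.1.1, q.2.1)) (H := nbhs (q.1.2, q.2.2))).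
  apply: (cvg_pair (G := nbhs q.1.1) (H := nbhs q.2.1)).
    by apply: (@continuous_comp _ _ _ fst fst); exact: cvg_fst.
  by apply: (@continuous_comp _ _ _ snd fst); [exact: cvg_snd|exact: cvg_fst].
apply: (cvg_pair (G := nbhs q.1.2) (H := nbhs q.2.2)).
  by apply: (@continuous_comp _ _ _ fst snd); [exact: cvg_fst|exact: cvg_snd].
by apply: (@continuous_comp _ _ _ snd snd); exact: cvg_snd.
Qed.

Lemma continuous_interchange_fst (A B C D U : topologicalType)
    (s : A -> C -> U) :
  continuous (fun p : A * C => s p.1 p.2) ->
  continuous (fun q : (A * B) * (C * D) => s q.1.1 q.2.1).
Proof.
move=> cs q; apply: (@continuous_comp _ _ _ (fun q => (interchange q).1)
  (fun p : A * C => s p.1 p.2)); last exact: cs.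
by apply: (@continuous_comp _ _ _ (@interchange A B C D) fst);
  [exact: interchange_continuous|exact: cvg_fst].
Qed.

Lemma continuous_interchange_snd (A B C D U : topologicalType)
    (s : B -> D -> U) :
  continuous (fun p : B * D => s p.1 p.2) ->
  continuous (fun q : (A * B) * (C * D) => s q.1.2 q.2.2).
Proof.
move=> cs q; apply: (@continuous_comp _ _ _ (fun q => (interchange q).2)
  (fun p : B * D => s p.1 p.2)); last exact: cs.
by apply: (@continuous_comp _ _ _ (@interchange A B C D) snd);
  [exact: interchange_continuous|exact: cvg_snd].
Qed.

(** * Initial topologies *)

Section InitialFamily.
Context (I : Type) (Y U : topologicalType) (D : set I) (g : I -> Y -> U).

Definition initial_family : Prop :=
  forall (F : set_system Y) (y : Y), Filter F ->
  F --> y <-> forall i, D i -> g i @ F --> g i y.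

Hypothesis gP : initial_family.

Lemma initial_family_continuous i : D i -> continuous (g i).
Proof. by move=> Di y; exact: (gP y (nbhs_filter y)).1 cvg_id i Di. Qed.

Lemma initial_family_hausdorff : hausdorff_space U ->
  (forall x y, (forall i, D i -> g i x = g i y) -> x = y) -> hausdorff_space Y.
Proof.
move=> hU sep x y xy; apply: sep => i Di.
by apply: (cluster_cvg_eq hU xy); exact: initial_family_continuous.
Qed.

Lemma initial_family_regular : regular_space U -> regular_space Y.
Proof.
move=> rU y; apply/gP.
  apply: filter_from_filter => [|A B nA nB].
    by exists setT; exact: filterT.
  by exists (A `&` B); [exact: filterI|exact: closureI].
move=> i Di A /rU[B nB BA].
have ni := initial_family_continuous Di; exists (g i @^-1` B); first exact: ni.
move=> x clx; apply: BA => C nC.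
by have [z [Bz Cz]] := clx _ (ni x C nC); exists (g i z).
Qed.

Lemma initial_family_second_countable : countable D -> @second_countable U ->
  @second_countable Y.
Proof.
move=> cD [B cB [oB bB]].
pose subbase := \bigcup_(i in D) [set g i @^-1` V | V in B].
exists (finI_from subbase id).
  apply: finI_from_countable; apply: bigcup_countable => // i Di.
  by apply: sub_countable cB; exact: card_image_le.
split=> [_ [E Esub <-]|y].
  rewrite openE => y Ey; apply: filter_bigI => V EV.
  have /set_mem[i Di [W BW WV]] := Esub _ EV.
  apply: open_nbhs_nbhs; split; last exact: Ey.
  rewrite -WV; apply: open_comp; last exact: oB.
  by move=> x _; exact: initial_family_continuous.
apply/gP.
  apply: filter_from_filter => [|V W [SV Vy] [SW Wy]].
    exists setT => //; split=> //.
    by exists fset0 => //; rewrite set_fset0 bigcap_set0.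
  by exists (V `&` W) => //; split; [exact: finI_fromI|split].
move=> i Di A /bB[V [BV Vy] VA].
exists (g i @^-1` V); last by move=> x /VA.
by split=> //; apply: (finI_from1 id); exists i => //; exists V.
Qed.

End InitialFamily.

Section InitialTopology.
Context (I : Type) (Y : pointedType) (U : topologicalType) (D : set I).
Context (g : I -> Y -> U).

Let W := sup_topology
  (fun i : {i | D i} => Topological.on (initial_topology (g (sval i)))).

Definition family_topology : topology Y :=
  Topology (@openT W) (@openI W) (fun J f oJ => bigcup_open (fun j _ => oJ j)).

Lemma family_topologyP :
  initial_family D (g : I -> top_space family_topology -> U).
Proof.
move=> F y FF.
have nbhsW : nbhs (y : top_space family_topology) = nbhs (y : W).
  by rewrite !nbhsE.
have initial_cvg i : F --> (y : initial_topology (g i)) <-> g i @ F --> g i y.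
  split=> Fy.
    by apply: (cvg_comp _ _ Fy); exact: (@initial_continuous Y U (g i) y).
  move=> A [_ [[B oB <-] Bgy BA]]; apply: filterS BA _.
  by apply: Fy; exact: open_nbhs_nbhs.
split=> [Fy i Di|Fg].
  apply/initial_cvg; have {}Fy : F --> (y : W) by rewrite /= -nbhsW.
  exact: (cvg_sup _ _ FF).1 Fy (exist _ i Di).
suff Fy : F --> (y : W) by rewrite /= nbhsW.
by apply/cvg_sup => -[i Di]; apply/initial_cvg; exact: Fg.
Qed.

Lemma family_topology_coarsest (T : topology Y) :
  (forall i, D i -> continuous (g i : top_space T -> U)) ->
  opens family_topology `<=` opens T.
Proof.
move=> cg.
suff /continuousP : continuous (id : top_space T -> top_space family_topology).
  by [].
move=> y; apply/(family_topologyP _ (nbhs_filter (y : top_space T))) => i Di.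
exact: cg.
Qed.

End InitialTopology.

(** * Time separation functions on topological spaces *)

Lemma compact_near_uniform (R : realType) (P Q : topologicalType)
    (V : pseudoMetricType R) (s : P -> Q -> V) (B : set Q) (x : P) (e : R) :
  continuous (fun p : P * Q => s p.1 p.2) -> compact B -> 0 < e ->
  \forall c \near x, forall y, B y -> ball (s x y) e (s c y).
Proof.
move=> s_cont /compact_near_coveringP cB e0.
apply: (cB _ (nbhs x) (fun c y => ball (s x y) e (s c y))) => y By.
have [[U W] /= [nU nW] UW] :
    nbhs (x, y) [set p | ball (s x y) (e / 2) (s p.1 p.2)].
  by apply: s_cont; apply: nbhsx_ballx; rewrite divr_gt0.
exists (W, U) => // -[y' c] /= [Wy' Uc].
apply: ball_splitr; first exact: (UW (x, y') (conj (nbhs_singleton nU) Wy')).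
exact: (UW (c, y')).
Qed.

Lemma compact_uniform_net (R : realType) (P : ptopologicalType)
    (Q : topologicalType) (V : pseudoMetricType R) (s : P -> Q -> V)
    (A : set P) (B : set Q) (e : R) :
  continuous (fun p : P * Q => s p.1 p.2) -> compact A -> compact B -> 0 < e ->
  exists2 N : set P, finite_set N /\ N `<=` A &
    forall x, A x -> exists2 c, N c & forall y, B y -> ball (s x y) e (s c y).
Proof.
move=> s_cont; rewrite compact_cover => cA cB e0.
pose U c := [set x | forall y, B y -> ball (s x y) e (s c y)]°.
have [c _||N NA AN] := cA P A U; first exact: open_interior.
  move=> x Ax; exists x => //; rewrite /U/interior/=.
  apply: filterS (compact_near_uniform x s_cont cB e0) => c xc y By.
  exact/ball_sym/xc.
exists [set` N].
  by split; [exact: finite_fset|move=> x /NA; rewrite inE].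
by move=> x /AN[c Nc /interior_subset]; exists c.
Qed.

Section TimelikeCore.
Context (R : realType) (X : Type) (tau : X -> X -> R).

Definition tau_pair (z x : X) : R * R := (tau z x, tau x z).

Definition timelike_core (A : set X) (e : R) : set X :=
  [set x | exists2 y, A y & e <= tau x y \/ e <= tau y x].

Lemma tau_pairC x y z w :
  tau_pair x y = tau_pair z w -> tau_pair y x = tau_pair w z.
Proof. by case=> xy yx; rewrite /tau_pair xy yx. Qed.

Lemma tau_pair_boundary i x : is_spacelike_boundary tau i ->
  tau_pair i x = 0 /\ tau_pair x i = 0.
Proof. by move=> /(_ x)[ix xi]; rewrite /tau_pair ix xi. Qed.

Lemma timelike_core_le A e e' :
  e <= e' -> timelike_core A e' `<=` timelike_core A e.
Proof.
move=> ee' x [y Ay [xy|yx]]; exists y => //.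
  by left; exact: le_trans xy.
by right; exact: le_trans yx.
Qed.

Lemma timelike_core_nonboundary A e x : 0 < e -> timelike_core A e x ->
  ~ is_spacelike_boundary tau x.
Proof. by move=> e0 [y _] + /(_ y)[xy yx]; rewrite xy yx leNgt e0; case. Qed.

Lemma cvg_tau_pair (T : Type) (F : set_system T) {FF : Filter F} (h : T -> X)
    z x :
  tau_pair z (h t) @[t --> F] --> tau_pair z x ->
  tau z (h t) @[t --> F] --> tau z x /\ tau (h t) z @[t --> F] --> tau x z.
Proof.
move=> hx; split.
  by apply: (@cvg_comp _ _ _ (tau_pair z \o h) fst _ _ _ hx); exact: cvg_fst.
by apply: (@cvg_comp _ _ _ (tau_pair z \o h) snd _ _ _ hx); exact: cvg_snd.
Qed.

Lemma near_timelike (T : Type) (F : set_system T) {FF : Filter F} (h : T -> X)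
    z x :
  tau_pair z (h t) @[t --> F] --> tau_pair z x -> 0 < tau z x \/ 0 < tau x z ->
  \forall t \near F, 0 < tau z (h t) \/ 0 < tau (h t) z.
Proof.
move=> /cvg_tau_pair[zh hz] [zx|xz].
  have : \forall t \near F, 0 < tau z (h t) by exact: cvgr_gt zh _ zx.
  by apply: filterS => t; left.
have : \forall t \near F, 0 < tau (h t) z by exact: cvgr_gt hz _ xz.
by apply: filterS => t; right.
Qed.

Hypothesis tau_ge0 : forall x y, 0 <= tau x y.

Lemma nonboundary_timelike x : ~ is_spacelike_boundary tau x ->
  exists2 z, ~ is_spacelike_boundary tau z & 0 < tau x z \/ 0 < tau z x.
Proof.
move=> /existsNP[z nz].
have xz : 0 < tau x z \/ 0 < tau z x.
  rewrite !lt0r !tau_ge0 !andbT; have [x0|] := eqVneq (tau x z) 0; last by left.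
  by right; apply/eqP => z0; apply: nz.
by exists z => // /(_ x)[zx0 xz0]; move: xz; rewrite zx0 xz0 ltxx; case.
Qed.

Lemma nonboundary_timelike_core x : ~ is_spacelike_boundary tau x ->
  exists2 e, 0 < e & timelike_core setT e x.
Proof.
move=> /nonboundary_timelike[z _ [xz|zx]].
  by exists (tau x z) => //; exists z => //; left.
by exists (tau z x) => //; exists z => //; right.
Qed.

End TimelikeCore.

Section ProperOn.
Context (R : realType) (P : topologicalType).
Implicit Types (S : set P) (s : P -> P -> R).

Definition proper_on S s : Prop :=
  continuous (fun p : P * P => s p.1 p.2) /\
  forall e : R, 0 < e -> compact ((S `*` S) `&` [set p | e <= s p.1 p.2]).

Lemma proper_on_closed S s : closed S -> proper_on setT s -> proper_on S s.
Proof.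
move=> cS [s_cont s_compact]; split=> // e /s_compact ce.
rewrite setXTT setTI in ce; rewrite setIC.
by apply: compact_closedI => //; exact: closedX.
Qed.

Lemma proper_on_timelike_core_compact S s e : proper_on S s -> 0 < e ->
  compact (S `&` timelike_core s S e).
Proof.
move=> [_ s_compact] /s_compact; set K := (X in compact X) => cK.
rewrite (_ : S `&` _ = fst @` K `|` snd @` K).
  by apply: compactU; apply: continuous_compact => //;
    apply: continuous_subspaceT => p; [exact: cvg_fst|exact: cvg_snd].
apply/seteqP; split=> [x [Sx [y Sy [xy|yx]]]|x [] [[u v] [[/= Su Sv] uv] <-]].
- by left; exists (x, y).
- by right; exists (y, x).
- by split=> //; exists v => //; left.
- by split=> //; exists u => //; right.
Qed.

Lemma proper_on_pair_continuous S s : proper_on S s ->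
  continuous (fun p : P * P => tau_pair s p.1 p.2).
Proof.
move=> [s_cont _] p.
apply: (cvg_pair (G := nbhs (s p.1 p.2)) (H := nbhs (s p.2 p.1))).
  exact: s_cont.
apply: (@continuous_comp _ _ _ (fun q : P * P => (q.2, q.1))
  (fun q : P * P => s q.1 q.2)); last exact: s_cont.
exact: swap_continuous.
Qed.

Lemma proper_on_section_continuous S s z : proper_on S s ->
  continuous (tau_pair s z).
Proof.
move=> /proper_on_pair_continuous sP x.
apply: (@continuous_comp _ _ _ (pair z) (fun p : P * P => tau_pair s p.1 p.2)).
  by apply: cvg_pair; [exact: cvg_cst|exact: cvg_id].
exact: sP.
Qed.

End ProperOn.

Definition sections_dense (R : realType) (X : Type) (tau : X -> X -> R)
    (D : set X) : Prop :=
  forall z, ~ is_spacelike_boundary tau z ->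
    exists2 c : nat -> X, (forall n, D (c n)) &
      forall y, tau_pair tau y (c n) @[n --> \oo] --> tau_pair tau y z.

Lemma sections_dense_separating (R : realType) (X : Type) (tau : X -> X -> R)
    (D : set X) :
  (forall x y, x <> y -> exists z, tau_pair tau z x <> tau_pair tau z y) ->
  sections_dense tau D ->
  forall x y, (forall c, D c -> tau_pair tau c x = tau_pair tau c y) -> x = y.
Proof.
move=> tau_sep D_dense x y Dxy; apply: contrapT => /tau_sep[z]; apply.
have [bz|/D_dense[c Dc cz]] := pselect (is_spacelike_boundary tau z).
  by rewrite !(tau_pair_boundary _ bz).1.
have hR2 := hausdorff_prod (@Rhausdorff R) (@Rhausdorff R).
apply: tau_pairC; apply: (@cvg_unique _ hR2 _ _ _ _ (cz x)).
rewrite (_ : (fun n => tau_pair tau x (c n)) = fun n => tau_pair tau y (c n)).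
  exact: cz.
by apply/funext => n; apply/tau_pairC/Dxy.
Qed.

Lemma uniform_sections_dense (R : realType) (X : Type) (tau : X -> X -> R)
    (D : set X) :
  (forall x y, 0 <= tau x y) ->
  (forall z e, ~ is_spacelike_boundary tau z -> 0 < e -> exists2 c, D c &
     forall y, timelike_core tau setT e y ->
       ball (tau_pair tau y z) e (tau_pair tau y c)) ->
  sections_dense tau D.
Proof.
move=> tau_ge0 Dnet z nz.
have arch (e : R) : 0 < e -> \forall n \near \oo, n.+1%:R^-1 < e.
  by move=> e0; exact: near_infty_natSinv_lt (PosNum e0).
have /choice[c cP] n : exists c, D c /\
    forall y, timelike_core tau setT n.+1%:R^-1 y ->
      ball (tau_pair tau y z) n.+1%:R^-1 (tau_pair tau y c).
  by have [|c Dc cP] := Dnet z n.+1%:R^-1 nz; [rewrite invr_gt0|exists c].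
exists c => [n|y]; first exact: (cP n).1.
have [yb|/(nonboundary_timelike_core tau_ge0)[t t0 yt]] :=
  pselect (is_spacelike_boundary tau y).
  rewrite (tau_pair_boundary _ yb).1 (_ : (fun n => _) = cst 0).
    exact: cvg_cst.
  by apply/funext => n; rewrite (tau_pair_boundary _ yb).1.
apply/cvg_ballP => e e0; near=> n.
apply: (@le_ball _ _ _ n.+1%:R^-1); first by apply: ltW; near: n; exact: arch.
apply: (cP n).2; apply: timelike_core_le yt.
by apply: ltW; near: n; exact: arch.
Unshelve. all: by end_near. Qed.

Section DistancePreservingImage.
Context (R : realType) (P X : Type).
Context (S : set P) (s : P -> P -> R) (tau : X -> X -> R) (f : P -> X).
Hypothesis f_tau : forall p q, S p -> S q -> tau (f p) (f q) = s p q.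
Hypothesis f_cover : forall x, ~ is_spacelike_boundary tau x -> (f @` S) x.

Lemma tau_pair_image p q : S p -> S q ->
  tau_pair tau (f p) (f q) = tau_pair s p q.
Proof. by move=> Sp Sq; rewrite /tau_pair !f_tau. Qed.

Lemma timelike_core_image e : 0 < e ->
  f @` (S `&` timelike_core s S e) = timelike_core tau setT e.
Proof.
move=> e0; apply/seteqP; split=> [_ [p [Sp [q Sq pq]] <-]|x cx].
  by exists (f q); rewrite // !f_tau.
have [p Sp px] := f_cover (timelike_core_nonboundary e0 cx).
have [z _ xz] := cx.
have cz : timelike_core tau setT e z by exists x => //; exact/or_comm.
have [q Sq qz] := f_cover (timelike_core_nonboundary e0 cz).
by exists p => //; split=> //; exists q => //; rewrite -!f_tau// px qz.
Qed.

End DistancePreservingImage.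

Section Presentation.
Context (R : realType) (P : ptopologicalType) (X : Type).
Context (S : set P) (s : P -> P -> R) (tau : X -> X -> R) (f : P -> X).
Hypothesis s_proper : proper_on S s.
Hypothesis f_tau : forall p q, S p -> S q -> tau (f p) (f q) = s p q.
Hypothesis f_cover : forall x, ~ is_spacelike_boundary tau x -> (f @` S) x.

Lemma timelike_core_net e : 0 < e -> exists2 N : set X, finite_set N &
  forall z, timelike_core tau setT e z -> exists2 c, N c &
    forall y, timelike_core tau setT e y ->
      ball (tau_pair tau y z) e (tau_pair tau y c).
Proof.
move=> e0; have core_compact := proper_on_timelike_core_compact s_proper e0.
have [||N [fN NS] netN] := @compact_uniform_net R P P _
  (fun p q => tau_pair s q p) _ _ e _ core_compact core_compact.
- move=> p; apply: (@continuous_comp _ _ _ (fun q => (q.2, q.1))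
    (fun q : P * P => tau_pair s q.1 q.2)).
    exact: swap_continuous.
  exact: proper_on_pair_continuous s_proper _.
- exact: e0.
exists (f @` N); first exact: finite_image.
rewrite -(timelike_core_image f_tau f_cover e0).
move=> _ [p /[dup] [[Sp _]] /netN[c Nc pc] <-]; exists (f c); first by exists c.
have [Sc _] := NS c Nc; move=> _ [q /[dup] [[Sq _]] /pc qpc <-].
by rewrite !(tau_pair_image f_tau).
Qed.

Lemma countable_sections_dense : (forall x y, 0 <= tau x y) ->
  exists2 D : set X, countable D & sections_dense tau D.
Proof.
move=> tau_ge0.
have /choice[N NP] n : exists N : set X, finite_set N /\
    forall z, timelike_core tau setT n.+1%:R^-1 z -> exists2 c, N c &
      forall y, timelike_core tau setT n.+1%:R^-1 y ->
        ball (tau_pair tau y z) n.+1%:R^-1 (tau_pair tau y c).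
  by have [|N] := @timelike_core_net n.+1%:R^-1; [rewrite invr_gt0|exists N].
exists (\bigcup_n N n).
  by apply: bigcup_countable => // n _; exact: finite_set_countable (NP n).1.
apply: uniform_sections_dense => // z e nz e0.
have [r r0 zr] := nonboundary_timelike_core tau_ge0 nz.
have [n] : exists n, 0 + n.+1%:R^-1 < Num.min e r.
  by apply: ltr_add_invr; rewrite lt_min e0.
rewrite add0r lt_min => /andP[/ltW ne /ltW nr].
have [c Nc cP] := (NP n).2 z (timelike_core_le nr zr).
exists c; first by exists n.
by move=> y ye; apply: (le_ball ne); apply: cP; exact: timelike_core_le ye.
Qed.

End Presentation.

Lemma timelike_core_nbhs (R : realType) (Z : topologicalType)
    (tau : Z -> Z -> R) (A : set Z) (c x : Z) :
  A c -> {for x, continuous (tau_pair tau c)} -> 0 < tau x c \/ 0 < tau c x ->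
  exists2 e, 0 < e & nbhs x (timelike_core tau A e).
Proof.
move=> Ac c_cont; have [cx xc] := cvg_tau_pair (h := id) c_cont.
case=> [xc0|cx0].
  exists (tau x c / 2); first by rewrite divr_gt0.
  have : \forall y \near x, tau x c / 2 <= tau y c by apply: cvgr_ge xc _ _; lra.
  by apply: filterS => y xy; exists c => //; left.
exists (tau c x / 2); first by rewrite divr_gt0.
have : \forall y \near x, tau c x / 2 <= tau c y by apply: cvgr_ge cx _ _; lra.
by apply: filterS => y xy; exists c => //; right.
Qed.

(* The initial topology of a dense family of sections is admissible: it is
   Hausdorff, so the superlevel sets, being compact images, are closed; this
   gives continuity where [tau] vanishes.  Elsewhere [tau] is continuous on a
   neighbourhood that is a compact image of a subset of [P * P]. *)
Section InitialProper.
Context (R : realType) (P : ptopologicalType) (Z : topologicalType).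
Context (S : set P) (s : P -> P -> R) (tau : Z -> Z -> R).
Context (f : P -> Z) (D : set Z).
Hypothesis s_proper : proper_on S s.
Hypothesis f_tau : forall p q, S p -> S q -> tau (f p) (f q) = s p q.
Hypothesis f_cover : forall x, ~ is_spacelike_boundary tau x -> (f @` S) x.
Hypothesis tau_ge0 : forall x y, 0 <= tau x y.
Hypothesis tau_sep : forall x y, x <> y ->
  exists z, tau_pair tau z x <> tau_pair tau z y.
Hypothesis Z_initial : initial_family D (tau_pair tau).
Hypothesis D_dense : sections_dense tau D.

Let hausdorff_Z : hausdorff_space Z.
Proof.
apply: (initial_family_hausdorff Z_initial).
  exact: hausdorff_prod (@Rhausdorff R) (@Rhausdorff R).
exact: sections_dense_separating D_dense.
Qed.

Lemma presentation_continuous : {within S, continuous f}.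
Proof.
apply/subspace_continuousP => p Sp; apply/Z_initial => c Dc.
suff : tau_pair tau c (f q) @[q --> within S (nbhs p)] --> tau_pair tau c (f p).
  by [].
have [bc|/f_cover[r Sr <-]] := pselect (is_spacelike_boundary tau c).
  rewrite (tau_pair_boundary _ bc).1 (_ : (fun q => _) = cst 0).
    exact: cvg_cst.
  by apply/funext => q /=; rewrite (tau_pair_boundary _ bc).1.
rewrite (tau_pair_image f_tau)//.
have : tau_pair s r q @[q --> within S (nbhs p)] --> tau_pair s r p.
  by apply: cvg_within_filter; exact: proper_on_section_continuous s_proper _.
apply: cvg_trans; apply: near_eq_cvg; near=> q.
by rewrite /= (tau_pair_image f_tau)//; near: q; exact: withinT.
Unshelve. all: by end_near. Qed.

Let f2 (p : P * P) : Z * Z := (f p.1, f p.2).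

Let f2_continuous (K : set (P * P)) : K `<=` S `*` S -> {within K, continuous f2}.
Proof.
move=> KS; apply: continuous_subspaceW KS _.
by apply: within_continuous_prod; exact: presentation_continuous.
Qed.

Lemma initial_superlevel_compact e : 0 < e ->
  compact [set p : Z * Z | e <= tau p.1 p.2].
Proof.
move=> e0.
rewrite (_ : [set p | _] = f2 @` ((S `*` S) `&` [set p | e <= s p.1 p.2])).
  apply: continuous_compact; first by apply: f2_continuous => p [].
  exact: s_proper.2.
apply/seteqP; split=> [[x y]/= exy|_ [[p q] [[/= Sp Sq] epq] <-]]; last first.
  by rewrite /= f_tau.
have nonboundary z : timelike_core tau setT e z -> (f @` S) z.
  by move=> /(timelike_core_nonboundary e0); exact: f_cover.
have [|p Sp px] := nonboundary x; first by exists y => //; left.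
have [|q Sq qy] := nonboundary y; first by exists x => //; right.
by exists (p, q); rewrite /f2/= ?px ?qy//; split=> //; rewrite -f_tau// px qy.
Qed.

Lemma timelike_core_prod_continuous e : 0 < e ->
  {within timelike_core tau setT e `*` timelike_core tau setT e,
    continuous (fun p : Z * Z => tau p.1 p.2)}.
Proof.
move=> e0; pose K := S `&` timelike_core s S e.
have -> : timelike_core tau setT e `*` timelike_core tau setT e =
    f2 @` (K `*` K).
  rewrite -(timelike_core_image f_tau f_cover e0); apply/seteqP.
  split=> [[_ _] [/= [p Kp <-] [q Kq <-]]|_ [[p q] [/= Kp Kq] <-]].
    by exists (p, q).
  by split; [exists p|exists q].
apply: (compact_image_continuous (h := fun p => s p.1 p.2)).
- exact: hausdorff_prod hausdorff_Z hausdorff_Z.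
- by apply: compact_setX; exact: proper_on_timelike_core_compact.
- by apply: f2_continuous => p [[? _] [? _]].
- exact: s_proper.1.
- by move=> [p q]; rewrite inE => -[[/= Sp _] [Sq _]] /=; rewrite f_tau.
Qed.

Lemma initial_timelike_core_nbhs x : ~ is_spacelike_boundary tau x ->
  exists2 e, 0 < e & nbhs x (timelike_core tau setT e).
Proof.
move=> /(nonboundary_timelike tau_ge0)[z /D_dense[c Dc cz] xz].
have /filter_ex[n xcn] : \forall n \near \oo,
    0 < tau x (c n) \/ 0 < tau (c n) x by exact: near_timelike (cz x) xz.
apply: timelike_core_nbhs xcn => //.
exact: (initial_family_continuous Z_initial).
Qed.

Lemma initial_proper : proper_on setT tau.
Proof.
split=> [[x y]|e e0]; last first.
  by rewrite setXTT setTI; exact: initial_superlevel_compact.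
have [xy0|] := ltP 0 (tau x y); last first.
  rewrite le_eqVlt ltNge tau_ge0 orbF => /eqP xy0.
  rewrite /continuous_at /= xy0.
  apply/cvgrPdist_lt => e e0.
  have c_e : closed [set p : Z * Z | e <= tau p.1 p.2].
    apply: compact_closed; first exact: hausdorff_prod hausdorff_Z hausdorff_Z.
    exact: initial_superlevel_compact.
  have nxy : ~ e <= tau (x, y).1 (x, y).2 by rewrite xy0 leNgt e0.
  apply: filterS (setC_nbhs c_e nxy) => p /negP.
  by rewrite -ltNge sub0r normrN ger0_norm.
have [e1 e1_gt0 nx] : exists2 e, 0 < e & nbhs x (timelike_core tau setT e).
  by apply: initial_timelike_core_nbhs => bx; rewrite (bx y).1 ltxx in xy0.
have [e2 e2_gt0 ny] : exists2 e, 0 < e & nbhs y (timelike_core tau setT e).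
  by apply: initial_timelike_core_nbhs => bd; rewrite (bd x).2 ltxx in xy0.
pose e := Num.min e1 e2; have e_gt0 : 0 < e by rewrite lt_min e1_gt0.
pose N := timelike_core tau setT e.
have nN : nbhs (x, y) (N `*` N).
  by exists (N, N) => //; split=> /=; [move: nx|move: ny]; apply: filterS;
    apply: timelike_core_le; rewrite ge_min lexx ?orbT.
rewrite /continuous_at -(within_interior nN).
have /subspace_continuousP := timelike_core_prod_continuous e_gt0.
by apply; exact: nbhs_singleton nN.
Qed.

End InitialProper.

(** * The coarsest admissible topology *)

Lemma tau_topologyE (R : realType) (X : pointedType) (tau : X -> X -> R)
    (T : topology X) :
  tau_topology tau T <-> proper_on (setT : set (top_space T)) tau.
Proof.
by split=> -[tau_cont tau_compact]; split=> // e /tau_compact;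
  rewrite setXTT setTI.
Qed.

Lemma topology_eq (X : Type) (T T' : topology X) : opens T = opens T' -> T = T'.
Proof.
case: T T' => [op opT opI opU] [op' opT' opI' opU'] /= opE; subst op'.
by congr Topology; exact: Prop_irrelevance.
Qed.

Lemma coarsest_topology_family (R : realType) (X : pointedType)
    (tau : X -> X -> R) (D : set X) :
  tau_topology tau (family_topology D (tau_pair tau)) ->
  coarsest_topology tau = family_topology D (tau_pair tau).
Proof.
move=> hD; apply: topology_eq; apply/seteqP; split=> [U hU|U oU].
  exact: hU.
rewrite /coarsest_topology/= => T /tau_topologyE hT.
apply: family_topology_coarsest oU => c _.
exact: proper_on_section_continuous hT.
Qed.

Lemma presentation_tau_topology (R : realType) (P : ptopologicalType)
    (X : pointedType) (S : set P) (s : P -> P -> R) (tau : X -> X -> R)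
    (f : P -> X) :
  proper_on S s ->
  (forall p q, S p -> S q -> tau (f p) (f q) = s p q) ->
  (forall x, ~ is_spacelike_boundary tau x -> (f @` S) x) ->
  (forall x y, 0 <= tau x y) ->
  (forall x y, x <> y -> exists z, tau_pair tau z x <> tau_pair tau z y) ->
  exists2 D : set X, countable D /\ sections_dense tau D &
    tau_topology tau (family_topology D (tau_pair tau)).
Proof.
move=> s_proper f_tau f_cover tau_ge0 tau_sep.
have [D cD D_dense] := countable_sections_dense s_proper f_tau f_cover tau_ge0.
exists D => //; apply/tau_topologyE.
apply: (@initial_proper R P (top_space (family_topology D (tau_pair tau))) S s
  tau f D) => //.
exact: family_topologyP.
Qed.

Section LorentzianTopology.
Context (R : realType) (X : pointedType) (tau : X -> X -> R).
Hypothesis tauP : is_blms tau.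

Lemma blms_pair_separation (x y : X) : x <> y ->
  exists z, tau_pair tau z x <> tau_pair tau z y.
Proof.
move=> /(blms_separation tauP)[z xyz]; exists z => -[zxy xzy].
by case: xyz.
Qed.

Lemma blms_boundary_unique (x y : X) :
  is_spacelike_boundary tau x -> is_spacelike_boundary tau y -> x = y.
Proof.
move=> bx yb; apply: contrapT => /blms_pair_separation[z]; apply.
by rewrite (tau_pair_boundary z bx).2 (tau_pair_boundary z yb).2.
Qed.

Lemma blms_initial : exists2 D : set X, countable D /\ sections_dense tau D &
  coarsest_topology tau = family_topology D (tau_pair tau) /\
  proper_on (setT : set (lspace tau)) tau.
Proof.
have [T /tau_topologyE T_proper] := blms_topology tauP.
have [||||D DP tauD] :=
  @presentation_tau_topology R (top_space T) X setT tau tau id T_proper.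
- by [].
- by move=> x _; exists x.
- exact: blms_ge0 tauP.
- exact: blms_pair_separation.
exists D => //; have coarsestD := coarsest_topology_family tauD.
by split=> //; apply/tau_topologyE; rewrite coarsestD.
Qed.

Lemma blms_proper : proper_on (setT : set (lspace tau)) tau.
Proof. by have [D _ []] := blms_initial. Qed.

Lemma blms_section_continuous (z : X) :
  continuous (tau_pair tau z : lspace tau -> R * R).
Proof. exact: proper_on_section_continuous blms_proper. Qed.

Lemma blms_initial_family :
  initial_family setT (tau_pair tau : lspace tau -> lspace tau -> R * R).
Proof.
move=> F x FF; split=> [Fx z _|Fx].
  by move=> A /(blms_section_continuous (x := x))/Fx.
have [D _ [coarsestD _]] := blms_initial; move: F x FF Fx; rewrite coarsestD.
by move=> F x FF Fx; apply/family_topologyP => z _; exact: Fx.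
Qed.

Lemma blms_sigma_compact : sigma_compact (lspace tau).
Proof.
pose boundary := [set x : lspace tau | is_spacelike_boundary tau x].
have boundary_compact : compact boundary.
  have [[x bx]|h] := pselect (exists x, is_spacelike_boundary tau x).
    rewrite (_ : boundary = [set (x : lspace tau)]); first exact: compact_set1.
    apply/seteqP; split=> [y yb|y ->//]; exact: blms_boundary_unique.
  rewrite (_ : boundary = set0); first exact: compact0.
  by apply/seteqP; split=> // y yb; apply: h; exists y.
exists (fun n => boundary `|` timelike_core tau setT n.+1%:R^-1).
  move=> n; apply: compactU => //; rewrite -[X in compact X]setTI.
  by apply: proper_on_timelike_core_compact blms_proper _; rewrite invr_gt0.
apply/seteqP; split=> // x _.
have [bx|/(nonboundary_timelike_core (blms_ge0 tauP))[e e0 xe]] :=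
  pselect (is_spacelike_boundary tau x); first by exists 0; [|left].
have [n] := ltr_add_invr e0; rewrite add0r => /ltW ne.
by exists n => //; right; exact: timelike_core_le xe.
Qed.

End LorentzianTopology.

(* By Urysohn's theorem these spaces are metrizable. *)
Record tame_space (T : topologicalType) : Prop := TameSpace {
  tame_hausdorff : hausdorff_space T;
  tame_regular : regular_space T;
  tame_second_countable : @second_countable T;
  tame_sigma_compact : sigma_compact T }.

Lemma blms_tame (R : realType) (X : pointedType) (tau : X -> X -> R) :
  is_blms tau -> tame_space (lspace tau).
Proof.
move=> tauP; have [D [cD D_dense] [coarsestD _]] := blms_initial tauP.
have := blms_sigma_compact tauP; rewrite coarsestD => sc.
have D_initial := @family_topologyP _ X (R * R)%type D (tau_pair tau).
split=> //.
- apply: (initial_family_hausdorff D_initial).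
    exact: hausdorff_prod (@Rhausdorff R) (@Rhausdorff R).
  exact: sections_dense_separating (blms_pair_separation tauP) D_dense.
- exact: initial_family_regular D_initial uniform_regular.
- apply: initial_family_second_countable D_initial cD _.
  by apply: second_countable_prod; exact: second_countable_realType.
Qed.

(** * Borel measures *)

Lemma measurable_preimage d d' (T : measurableType d) (U : measurableType d')
    (f : T -> U) (A : set U) :
  measurable_fun setT f -> measurable A -> measurable (f @^-1` A).
Proof. by move=> mf mA; rewrite -[X in measurable X]setTI; exact: mf. Qed.

Lemma ae_pushforward d d' (T : measurableType d) (T' : measurableType d')
    (R : realType) (m : {measure set T -> \bar R})
    (m' : {measure set T' -> \bar R}) (f : T -> T') (Q : set T') :
  measurable_fun setT f ->
  (forall A, measurable A -> pushforward m f A = m' A) ->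
  (\forall y \ae m', Q y) -> \forall x \ae m, Q (f x).
Proof.
move=> mf fm [N [mN N0 QN]]; exists (f @^-1` N); split.
- exact: measurable_preimage mf mN.
- by rewrite -N0 -fm.
- by move=> x /QN.
Qed.

Lemma ae_prod_fst d d' (T : measurableType d) (T' : measurableType d')
    (R : realType) (m : probability T R) (m' : probability T' R) (Q : set T) :
  (\forall x \ae m, Q x) -> \forall p \ae (m \x m')%E, Q p.1.
Proof.
apply: ae_pushforward; first exact: measurable_fst.
move=> A mA; transitivity ((m \x m')%E (A `*` setT)); first by rewrite setXT.
rewrite product_measure1E//.
by rewrite [X in (_ * X)%E](probability_setT m') mule1.
Qed.

Lemma ae_prod_snd d d' (T : measurableType d) (T' : measurableType d')
    (R : realType) (m : probability T R) (m' : probability T' R) (Q : set T') :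
  (\forall x \ae m', Q x) -> \forall p \ae (m \x m')%E, Q p.2.
Proof.
apply: ae_pushforward; first exact: measurable_snd.
move=> A mA; transitivity ((m \x m')%E (setT `*` A)); first by rewrite setTX.
rewrite product_measure1E//.
by rewrite [X in (X * _)%E](probability_setT m) mul1e.
Qed.

Section BorelSets.
Context (T U : ptopologicalType).

Lemma borel_open (V : set T) : open V -> measurable (V : set (borel T)).
Proof. by move=> oV; exact: sub_sigma_algebra. Qed.

Lemma borel_closed (F : set T) : closed F -> measurable (F : set (borel T)).
Proof.
move=> cF; rewrite -[F]setCK; apply: measurableC; apply: borel_open.
exact: closed_openC.
Qed.

Lemma borel_compact (K : set T) : hausdorff_space T -> compact K ->
  measurable (K : set (borel T)).
Proof. by move=> hT cK; apply: borel_closed; exact: compact_closed. Qed.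

Lemma within_continuous_measurable (D : set T) (f : T -> U) :
  {within D, continuous f} ->
  measurable_fun (D : set (borel T)) (f : borel T -> borel U).
Proof.
move=> cf mD; apply: (@measurability _ _ (borel T) (borel U) D f (@open U)) => //.
move=> _ [V oV <-].
have /open_subspaceP[W oW WD] : open (f @^-1` V : set (subspace D)).
  by apply: open_comp => // x _; exact: cf.
by rewrite setIC -WD; apply: measurableI => //; exact: borel_open.
Qed.

Lemma continuous_measurable (f : T -> U) :
  continuous f -> measurable_fun setT (f : borel T -> borel U).
Proof.
by move=> cf; apply: within_continuous_measurable; exact: continuous_subspaceT.
Qed.

End BorelSets.

HB.instance Definition _ (T1 T2 : ptopologicalType) :=
  Pointed.on (T1 * T2)%type.

Section ProductBorel.
Context (T1 T2 : ptopologicalType).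

Lemma measurable_fst_borel :
  measurable_fun setT (fst : borel (T1 * T2)%type -> borel T1).
Proof.
by apply: (@continuous_measurable (T1 * T2)%type T1 fst) => p; exact: cvg_fst.
Qed.

Lemma measurable_snd_borel :
  measurable_fun setT (snd : borel (T1 * T2)%type -> borel T2).
Proof.
by apply: (@continuous_measurable (T1 * T2)%type T2 snd) => p; exact: cvg_snd.
Qed.

Lemma borel_setX (A : set (borel T1)) (B : set (borel T2)) :
  measurable A -> measurable B ->
  measurable (A `*` B : set (borel (T1 * T2)%type)).
Proof.
move=> mA mB; rewrite (_ : A `*` B = fst @^-1` A `&` snd @^-1` B)//.
apply: measurableI.
  exact: measurable_preimage measurable_fst_borel mA.
exact: measurable_preimage measurable_snd_borel mB.
Qed.

End ProductBorel.

Section Support.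
Context (R : realType) (T : ptopologicalType).
Context (m : {measure set (borel T) -> \bar R}).

Definition support : set T :=
  [set x | forall U : set T, open U -> U x -> (0 < m U)%E].

Lemma support_closed : closed support.
Proof.
rewrite -[support]setCK; apply: open_closedC.
rewrite openE => x /existsNP[U /not_implyP[oU /not_implyP[Ux mU]]].
apply: filterS (open_nbhs_nbhs (conj oU Ux)).
by move=> y Uy /(_ U oU Uy).
Qed.

Lemma measurable_support : measurable (support : set (borel T)).
Proof. by apply: borel_closed; exact: support_closed. Qed.

Hypothesis scT : @second_countable T.

Lemma measure_setC_support : m (~` support) = 0%E.
Proof.
apply/negligibleP; first by apply: measurableC; exact: measurable_support.
have [B oB bB] := second_countable_seq scT.
pose N n := if (0 < m (B n))%E then set0 else B n.
have NP n : m.-negligible (N n).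
  rewrite /N measure_gt0; case: eqP => [mB|_]; last exact: negligible_set0.
  by apply/negligibleP => //; exact: borel_open.
apply: negligibleS (negligible_bigcup NP) => x /existsNP[U].
move=> /not_implyP[oU /not_implyP[Ux /negP mU]]; have [n Bx BU] := bB U x oU Ux.
exists n => //; rewrite /N ifN//; apply: contra mU => /lt_le_trans; apply.
by apply: le_measure => //; rewrite inE; exact: borel_open.
Qed.

Lemma measure_setI_support (A : set (borel T)) : measurable A ->
  m (support `&` A) = m A.
Proof.
move=> mA; have mS := measurable_support.
rewrite [RHS](measureDI m mA mS).
rewrite [X in (X + _)%E](_ : _ = 0%E) ?add0e 1?setIC//.
apply: subset_measure0 measure_setC_support; first exact: measurableD.
  exact: measurableC.
by move=> x [].
Qed.

End Support.

Lemma ae_eq_continuous_support (R : realType) (T1 T2 : ptopologicalType)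
    (U : topologicalType) (m1 : {measure set (borel T1) -> \bar R})
    (m2 : {sigma_finite_measure set (borel T2) -> \bar R}) (f g : T1 * T2 -> U)
    (x : T1) (y : T2) :
  hausdorff_space U -> continuous f -> continuous g ->
  {ae (m1 \x m2)%E, forall p, f p = g p} ->
  support m1 x -> support m2 y -> f (x, y) = g (x, y).
Proof.
move=> hU cf cg [N [mN N0 fgN]] m1x m2y.
apply: (closure_continuous_eq (A := [set p | f p = g p])) => //.
- exact: cf.
- exact: cg.
- by move=> p; rewrite inE.
move=> W [[V1 V2] [/= nV1 nV2] V12]; move: nV1 nV2; rewrite !nbhsE.
move=> -[A1 [oA1 A1x] A1V] [A2 [oA2 A2y] A2V]; apply: contrapT => noW.
have mA1 : measurable (A1 : set (borel T1)) := borel_open oA1.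
have mA2 : measurable (A2 : set (borel T2)) := borel_open oA2.
have : ((m1 \x m2)%E (A1 `*` A2) <= 0)%E.
  rewrite -N0; apply: le_measure; rewrite ?inE//; first exact: measurableX.
  move=> p [A1p A2p]; apply: fgN => fgp; apply: noW; exists p; split=> //.
  by apply: V12; split; [exact: A1V|exact: A2V].
rewrite product_measure1E// leNgt => /negP; apply.
by apply: mule_gt0; [exact: m1x|exact: m2y].
Qed.

(** * Regularity of finite Borel measures *)

Section Regularity.
Context (R : realType) (T : ptopologicalType).
Context (m : {finite_measure set (borel T) -> \bar R}).

Lemma measure_setD_bigcup_lt (V : set (borel T)) (F : nat -> set (borel T))
    (e : \bar R) :
  measurable V -> (forall n, measurable (F n)) ->
  (m (V `\` \bigcup_n F n) < e)%E ->
  exists N, (m (V `\` \big[setU/set0]_(i < N) F i) < e)%E.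
Proof.
move=> mV mF; pose D N := V `\` \big[setU/set0]_(i < N) F i.
have mD N : measurable (D N).
  by apply: measurableD => //; exact: bigsetU_measurable.
have -> : V `\` \bigcup_n F n = \bigcap_n D n.
  apply/seteqP; split=> [x [Vx nF] N _|x Dx].
    by split=> //; rewrite -bigcup_mkord => -[n _ Fx]; apply: nF; exists n.
  split=> [|[n _ Fx]]; first exact: (Dx 0 I).1.
  by apply: (Dx n.+1 I).2; rewrite big_ord_recr; right.
have D_cvg : m (D N) @[N --> \oo] --> m (\bigcap_n D n).
  apply: nonincreasing_cvg_mu => //; last 2 first.
  - exact: bigcap_measurable.
  - by move=> i j ij; apply/subsetPset; apply: setDS; exact: subset_bigsetU.
  by rewrite -ge0_fin_numE//; exact: fin_num_measure.
move=> De.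
have [N _ DN] := D_cvg _ (open_nbhs_nbhs (conj (@open_ereal_lt_ereal _ _) De)).
by exists N; exact: (DN N (leqnn N)).
Qed.

Definition closed_open_approx (A : set T) : Prop := forall e : R, 0 < e ->
  exists F U : set T, [/\ closed F, open U, F `<=` A, A `<=` U &
    (m (U `\` F) < e%:E)%E].

Lemma closed_open_approx_open (U : set T) : regular_space T ->
  @second_countable T -> open U -> closed_open_approx U.
Proof.
move=> rT /second_countable_seq[B oB bB] oU e e0.
pose F n := if `[< closure (B n) `<=` U >] then closure (B n) else set0.
have cF n : closed (F n).
  by rewrite /F; case: ifP => _; [exact: closed_closure|exact: closed0].
have UF : \bigcup_n F n = U.
  apply/seteqP; split=> [x [n _]|x Ux].
    by rewrite /F; case: asboolP => // BU /BU.
  have [V nV VU] := rT x U (open_nbhs_nbhs (conj oU Ux)).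
  move: nV; rewrite nbhsE => -[W [oW Wx] WV]; have [n Bx BW] := bB W x oW Wx.
  exists n => //; rewrite /F asboolT; first exact: subset_closure.
  by apply: subset_trans VU; apply: closureS; exact: subset_trans WV.
have [|n||N UN] := @measure_setD_bigcup_lt U F e%:E.
- exact: borel_open.
- exact: borel_closed.
- by rewrite UF setDv measure0 lte_fin.
exists (\big[setU/set0]_(i < N) F i), U; split=> //.
- by apply: closed_bigsetU => i _; exact: cF.
- by rewrite -bigcup_mkord => x [n _ Fx]; rewrite -UF; exists n.
Qed.

Lemma closed_open_approx_setC (A : set T) :
  closed_open_approx A -> closed_open_approx (~` A).
Proof.
move=> rA e /rA[F [U [cF oU FA AU UF]]]; exists (~` U), (~` F); split.
- exact: open_closedC.
- exact: closed_openC.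
- exact: subsetC.
- exact: subsetC.
- by rewrite setDE setCK setIC -setDE.
Qed.

Lemma closed_open_approx_bigcup (A : nat -> set T) :
  (forall n, closed_open_approx (A n)) -> closed_open_approx (\bigcup_n A n).
Proof.
move=> rA e e0; have en n : 0 < e / 2 / (2 ^ n.+1)%:R.
  by rewrite !divr_gt0// ltr0n expn_gt0.
have /choice[FU FUP] n : exists FU : set T * set T, [/\ closed FU.1, open FU.2,
    FU.1 `<=` A n, A n `<=` FU.2 &
    (m (FU.2 `\` FU.1) < (e / 2 / (2 ^ n.+1)%:R)%:E)%E].
  by have [F [U ?]] := rA n _ (en n); exists (F, U).
pose F n : set (borel T) := (FU n).1; pose U n : set (borel T) := (FU n).2.
have mF n : measurable (F n) by apply: borel_closed; have [] := FUP n.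
have mU n : measurable (U n) by apply: borel_open; have [] := FUP n.
have oU : open (\bigcup_n U n : set T).
  by apply: bigcup_open => n _; have [] := FUP n.
have UF : (m (\bigcup_n U n `\` \bigcup_n F n) <= (e / 2)%:E)%E.
  apply: (@le_trans _ _ (\sum_(0 <= n <oo) m (U n `\` F n))%E).
    apply: measure_sigma_subadditive.
    - by move=> n; exact: measurableD.
    - by apply: measurableD; exact: bigcup_measurable.
    - move=> x [[n _ Ux] nF]; exists n => //.
      by split=> // Fx; apply: nF; exists n.
  apply: le_trans (epsilon_trick0 xpredT _); last by rewrite divr_ge0// ltW.
  apply: lee_nneseries => [n *|n *]; first exact: measure_ge0.
  by apply: ltW; have [] := FUP n.
have [|//||N UN] := @measure_setD_bigcup_lt (\bigcup_n U n) F e%:E.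
- exact: borel_open.
- by apply: le_lt_trans UF _; rewrite lte_fin; lra.
exists (\big[setU/set0]_(i < N) F i), (\bigcup_n U n); split=> //.
- by apply: closed_bigsetU => i _; have [] := FUP i.
- rewrite -bigcup_mkord => x [n _ Fx]; exists n => //.
  by have [_ _ + _ _] := FUP n; exact.
- move=> x [n _ Ax]; exists n => //.
  by have [_ _ _ + _] := FUP n; exact.
Qed.

Lemma measurable_closed_open_approx (A : set (borel T)) : regular_space T ->
  @second_countable T -> measurable A -> closed_open_approx A.
Proof.
move=> rT scT; apply: smallest_sub; last first.
  by move=> U; exact: closed_open_approx_open.
split; last exact: closed_open_approx_bigcup.
- exact: closed_open_approx_open open0.
- by move=> B; rewrite setTD; exact: closed_open_approx_setC.
Qed.

Lemma measure_outer_open (A : set (borel T)) (e : R) : tame_space T ->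
  measurable A -> 0 < e ->
  exists U : set T, [/\ open U, A `<=` U & (m (U `\` A) < e%:E)%E].
Proof.
move=> tT mA e0.
have [F [U [cF oU FA AU UF]]] := measurable_closed_open_approx
  (tame_regular tT) (tame_second_countable tT) mA e0.
have [mF mU] := (borel_closed cF, borel_open oU).
exists U; split=> //; apply: le_lt_trans UF.
by apply: le_measure; rewrite ?inE; [exact: measurableD..|exact: setDS].
Qed.

Lemma measure_inner_compact (A : set (borel T)) (e : R) : tame_space T ->
  measurable A -> 0 < e ->
  exists K : set T, [/\ compact K, K `<=` A & (m (A `\` K) < e%:E)%E].
Proof.
move=> tT mA e0; have e20 : 0 < e / 2 by rewrite divr_gt0.
have [F [U [cF oU FA AU UF]]] := measurable_closed_open_approx
  (tame_regular tT) (tame_second_countable tT) mA e20.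
have [C cC CT] := tame_sigma_compact tT.
have cFC n : compact (F `&` C n) by rewrite setIC; exact: compact_closedI.
have mFC n : measurable (F `&` C n : set (borel T)).
  by apply: borel_compact => //; exact: tame_hausdorff.
have [mF mU] := (borel_closed cF, borel_open oU).
have [|N FN] := @measure_setD_bigcup_lt F (fun n => F `&` C n) (e / 2)%:E mF mFC.
  by rewrite -setI_bigcupr CT setIT setDv measure0 lte_fin.
pose K := \big[setU/set0]_(i < N) (F `&` C i).
have mK : measurable (K : set (borel T)) by exact: bigsetU_measurable.
exists K; split.
- by apply: bigsetU_compact => i _; exact: cFC.
- by rewrite /K -(bigcup_mkord N (fun i => F `&` C i)) => x [i _ [/FA]].
have AK : A `\` K `<=` (U `\` F) `|` (F `\` K).
  move=> x [Ax nK]; have [Fx|nF] := pselect (F x); first by right.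
  by left; split=> //; exact: AU.
apply: (@le_lt_trans _ _ (m ((U `\` F) `|` (F `\` K)))).
  apply: le_measure AK; rewrite inE; first exact: measurableD.
  by apply: measurableU; exact: measurableD.
apply: (le_lt_trans (measureU2 _ _ _)) => //; [exact: measurableD..|].
rewrite [e](_ : e = e / 2 + e / 2); last by lra.
by rewrite EFinD lteD.
Qed.

End Regularity.

(** * Gluing *)

Lemma probability_of_measure d (T : measurableType d) (R : realType)
    (m : {measure set T -> \bar R}) :
  m setT = 1%E -> exists P : probability T R, forall A, P A = m A.
Proof.
move=> mT; exists (mnormalize m (dirac point)) => A.
by rewrite /= /mnormalize mT onee_eq0/= invr1 mule1.
Qed.

Lemma pushforward_probability d d' (T : measurableType d)
    (T' : measurableType d') (R : realType) (P : probability T R) (f : T -> T') :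
  measurable_fun setT f ->
  exists Q : probability T' R, forall A, Q A = pushforward P f A.
Proof. by move=> mf; exists (distribution P (mfun_Sub (mem_set mf))). Qed.

Lemma measure_sum_finType d (T : measurableType d) (R : realType) (I : finType)
    (m : I -> {measure set T -> \bar R}) :
  exists M : {measure set T -> \bar R}, forall A, M A = (\sum_i m i A)%E.
Proof.
pose s := [seq m i | i <- enum I]; pose m0 : {measure set T -> \bar R} := mzero.
exists (msum (nth m0 s) #|I|) => A.
rewrite /= /msum -(big_mkord xpredT (fun k => nth m0 s k A)) cardE -(size_map m).
rewrite -(big_nth m0 xpredT (fun n : {measure set T -> \bar R} => n A)).
by rewrite big_map big_enum.
Qed.

Lemma measure_fibers d (T : measurableType d) (R : realType) (I : finType)
    (m : {measure set T -> \bar R}) (a : T -> I) (X : set T) :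
  (forall i, measurable (a @^-1` [set i])) -> measurable X ->
  m X = (\sum_i m (X `&` a @^-1` [set i]))%E.
Proof.
move=> ma mX.
have XE : X = \bigcup_i (X `&` a @^-1` [set i]).
  by apply/seteqP; split=> [x Xx|x [i _ []//]]; exists (a x).
rewrite {1}XE measure_fin_bigcup//; last 3 first.
- exact: finite_finset.
- by move=> i j _ _ [x [[_ xi] [_ xj]]]; rewrite -xi -xj.
- by move=> i _; exact: measurableI.
rewrite (fsbigE (index_enum I)) ?index_enum_uniq//.
  by apply: eq_bigl => i; rewrite in_setT.
by move=> i _; rewrite mem_index_enum.
Qed.

Lemma compact_ultra_cvg (I : Type) (T : topologicalType) (F : set_system I)
    (u : I -> T) (K : set T) : UltraFilter F -> compact K ->
  (\forall i \near F, K (u i)) -> exists2 l, K l & u i @[i --> F] --> l.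
Proof.
move=> FU cK FK; have [l [Kl Fl]] := cK (u i @[i --> F]) _ FK.
exists l => // A nA; have [//|FCA] := in_ultra_setVsetC (u @^-1` A) FU.
by have [x []] := Fl (~` A) A FCA nA.
Qed.

Lemma ultralimit_content d (T : measurableType d) (R : realType) (I : Type)
    (F : set_system I) (P : I -> probability T R) : UltraFilter F ->
  exists mu : {content set T -> \bar R},
    forall A, measurable A -> P i A @[i --> F] --> mu A.
Proof.
move=> FU; pose p i A := fine (P i A).
have PE i A : measurable A -> P i A = (p i A)%:E.
  by move=> mA; rewrite fineK//; exact: fin_num_measure.
have /choice[l lP] A :
    exists l : R, 0 <= l /\ (measurable A -> p i A @[i --> F] --> l).
  have [mA|nmA] := pselect (measurable A); last by exists 0.
  have [||l] := @compact_ultra_cvg I R F (p^~ A) `[0, 1] FU.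
  - exact: segment_compact.
  - apply: filterS filterT => i _.
    by rewrite /= in_itv/= -!lee_fin -PE// measure_ge0 probability_le1.
  by rewrite /= in_itv/= => /andP[l0 _] Fl; exists l.
have l_ge0 A : (0 <= (l A)%:E)%E by rewrite lee_fin (lP A).1.
have Pl A : measurable A -> P i A @[i --> F] --> (l A)%:E.
  move=> mA; rewrite (_ : (fun i => P i A) = EFin \o p^~ A).
    by apply: cvg_EFin; [exact: nearW|exact: (lP A).2].
  by apply/funext => i; rewrite PE.
have l_additive : measure_function.semi_additive (EFin \o l).
  move=> A n mA tA mU.
  apply: (@cvg_unique _ (@ereal_hausdorff R) _ _ _ _ (Pl _ mU)).
  rewrite (_ : (fun i => P i _) = fun i => (\sum_(k < n) P i (A k))%E).
    by apply: cvg_nnesum => k _; [exact: nearW|exact: Pl].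
  by apply/funext => i; exact: measure_semi_additive.
pose mu : {content set T -> \bar R} :=
  HB.pack (EFin \o l) (isContent.Build _ _ _ (EFin \o l) l_ge0 l_additive).
by exists mu.
Qed.

Section FiniteGluing.
Context (R : realType) (d1 d2 : measure_display) (I : finType).
Context (T1 : measurableType d1) (T2 : measurableType d2).
Context (m1 : probability T1 R) (m2 : probability T2 R).
Context (a : T1 -> I) (b : T2 -> I).
Hypothesis ma : forall i, measurable (a @^-1` [set i]).
Hypothesis mb : forall i, measurable (b @^-1` [set i]).
Hypothesis ab : forall i, m1 (a @^-1` [set i]) = m2 (b @^-1` [set i]).

Let fiber i := a @^-1` [set i] `*` b @^-1` [set i].

Let mfiber i : measurable (fiber i).
Proof. exact: measurableX. Qed.

Let weight_ge0 i : 0 <= (fine (m2 (b @^-1` [set i])))^-1.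
Proof. by rewrite invr_ge0 fine_ge0. Qed.

Let weight i : {nonneg R} := NngNum (weight_ge0 i).

Let weightK (x : \bar R) i : (0 <= x)%E -> (x <= m2 (b @^-1` [set i]))%E ->
  ((weight i)%:num%:E * (x * m2 (b @^-1` [set i])))%E = x.
Proof.
rewrite /= -{1 3}[m2 _]fineK ?fin_num_measure//; move: (fine _) => w.
case: x => [x| |]; rewrite ?leey_eq// !lee_fin => x0 xw.
rewrite -!EFinM; congr EFin; have [w0|w0] := eqVneq w 0.
  by rewrite w0 in xw *; rewrite mulr0 mulr0; apply/eqP; rewrite eq_le x0 xw.
by rewrite mulrCA mulVf// mulr1.
Qed.

(* The product measure conditionally on the common value of [a] and [b];
   fibres of measure zero have weight [0^-1 = 0]. *)
Lemma finite_gluing : exists P : probability (T1 * T2)%type R,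
  [/\ forall X, measurable X -> P (X `*` setT) = m1 X,
      forall Y, measurable Y -> P (setT `*` Y) = m2 Y &
      forall X Y, measurable X -> measurable Y ->
        (forall x y, X x -> Y y -> a x <> b y) -> P (X `*` Y) = 0%E].
Proof.
have [M ME] := measure_sum_finType
  (fun i => mscale (weight i) (mrestr (m1 \x m2)%E (mfiber i))).
have {}ME A :
    M A = (\sum_i (weight i)%:num%:E * (m1 \x m2) (A `&` fiber i))%E.
  by rewrite ME.
have M1 X : measurable X -> M (X `*` setT) = m1 X.
  move=> mX; rewrite ME (measure_fibers m1 ma mX); apply: eq_bigr => i _.
  rewrite -setXI setTI product_measure1E//; last exact: measurableI.
  rewrite weightK// -ab.
  by apply: le_measure; rewrite ?inE//; exact: measurableI.
have M2 Y : measurable Y -> M (setT `*` Y) = m2 Y.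
  move=> mY; rewrite ME (measure_fibers m2 mb mY); apply: eq_bigr => i _.
  rewrite -setXI setTI product_measure1E//; last exact: measurableI.
  rewrite [X in (_ * (X * _))%E]ab [X in (_ * X)%E]muleC weightK//.
  by apply: le_measure; rewrite ?inE//; exact: measurableI.
have [|P PE] := @probability_of_measure _ _ R M.
  by rewrite -setXTT M1// probability_setT.
exists P; split=> [X mX|Y mY|X Y mX mY abXY]; rewrite PE ?M1 ?M2// ME.
apply: big1 => i _; rewrite (_ : _ `&` _ = set0) ?measure0 ?mule0//.
apply/seteqP; split=> // -[x y] [[/= Xx Yy] [/= xi yi]].
by apply: (abXY x y) => //; rewrite xi yi.
Qed.

End FiniteGluing.

Definition rect_type (T1 T2 : Type) : Type := (T1 * T2)%type.

Definition rect_display : measure_display * measure_display -> measure_display.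
Proof. by case. Qed.

Section RectangleSemiring.
Context (d1 d2 : measure_display).
Context (T1 : measurableType d1) (T2 : measurableType d2).

Definition rectangles : set (set (rect_type T1 T2)) :=
  [set A `*` B | A in measurable & B in measurable].

Let rectangles0 : rectangles set0.
Proof. by exists set0 => //; exists set0 => //; rewrite setX0. Qed.

Let rectanglesI : setI_closed rectangles.
Proof.
move=> _ _ [A mA [B mB <-]] [A' mA' [B' mB' <-]]; rewrite -setXI.
exists (A `&` A'); first exact: measurableI.
by exists (B `&` B'); first exact: measurableI.
Qed.

Let rectanglesD : semi_setD_closed rectangles.
Proof.
move=> _ _ [A mA [B mB <-]] [A' mA' [B' mB' <-]].
exists [set (A `\` A') `*` B; (A `&` A') `*` (B `\` B')]; split.
- exact: finite_set2.
- move=> _ [->|->].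
    by exists (A `\` A'); [exact: measurableD|exists B].
  exists (A `&` A'); first exact: measurableI.
  by exists (B `\` B'); first exact: measurableD.
- rewrite bigcup_setU1 bigcup_set1; apply/seteqP.
  split=> [[x y] [[/= Ax By] nAB']|].
    have [A'x|] := pselect (A' x); last by left.
    by right; split=> //=; split=> // B'y; apply: nAB'.
  by move=> [x y] [[[/= Ax nA'] By]|[[/= Ax A'x] [By nB']]]; split=> // -[].
- by move=> _ _ [->|->] [->|->] [[x y]] [[/= [? ?] ?] [/= [? ?] ?]].
Qed.

HB.instance Definition _ := Pointed.on (rect_type T1 T2).
HB.instance Definition _ := @isSemiRingOfSets.Build (rect_display (d1, d2))
  (rect_type T1 T2) rectangles rectangles0 rectanglesI rectanglesD.

End RectangleSemiring.

Section RectangleExtension.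
Context (R : realType) (T1 T2 : ptopologicalType).
Context (m1 : probability (borel T1) R) (m2 : probability (borel T2) R).
Context (mu : {content set (borel T1 * borel T2)%type -> \bar R}).
Hypotheses (tT1 : tame_space T1) (tT2 : tame_space T2).
Hypothesis mu_fst : forall A, measurable A -> mu (A `*` setT) = m1 A.
Hypothesis mu_snd : forall B, measurable B -> mu (setT `*` B) = m2 B.

Implicit Types (A : set (borel T1)) (B : set (borel T2)).

Lemma content_rectangle_le A A' B B' : measurable A -> measurable A' ->
  measurable B -> measurable B' ->
  (mu (A' `*` B') <= mu (A `*` B) + (m1 (A' `\` A) + m2 (B' `\` B)))%E.
Proof.
move=> mA mA' mB mB'.
have mDA : measurable ((A' `\` A) `*` [set: borel T2]).
  by apply: measurableX => //; exact: measurableD.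
have mDB : measurable ([set: borel T1] `*` (B' `\` B)).
  by apply: measurableX => //; exact: measurableD.
pose excess : set (borel T1 * borel T2) :=
  (A' `\` A) `*` setT `|` setT `*` (B' `\` B).
have cover : A' `*` B' `<=` A `*` B `|` excess.
  move=> [x y] [/= A'x B'y]; have [Ax|nA] := pselect (A x); last by right; left.
  by have [By|nB] := pselect (B y); [left|right; right].
rewrite -mu_fst -?mu_snd; [|exact: measurableD..].
have mE : measurable excess by exact: measurableU.
apply: (@le_trans _ _ (mu (A `*` B `|` excess))).
  apply: le_measure cover; rewrite inE; first exact: measurableX.
  by apply: measurableU => //; exact: measurableX.
apply: (le_trans (measureU2 _ _ _)) => //; first exact: measurableX.
by apply: leeD2l; exact: measureU2.
Qed.

Lemma content_rectangle_inner_compact A B (e : R) : measurable A ->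
  measurable B -> 0 < e ->
  exists K L, [/\ compact (K : set T1), compact (L : set T2),
    K `<=` A, L `<=` B & (mu (A `*` B) <= mu (K `*` L) + e%:E)%E].
Proof.
move=> mA mB e0; have e20 : 0 < e / 2 by rewrite divr_gt0.
have [K [cK KA AK]] := measure_inner_compact m1 tT1 mA e20.
have [L [cL LB BL]] := measure_inner_compact m2 tT2 mB e20.
have mK : measurable (K : set (borel T1)).
  exact: borel_compact (tame_hausdorff tT1) cK.
have mL : measurable (L : set (borel T2)).
  exact: borel_compact (tame_hausdorff tT2) cL.
exists K, L; split=> //; apply: le_trans (content_rectangle_le mK mA mL mB) _.
rewrite [e in e%:E](splitr e) EFinD.
by apply: leeD2l; apply: leeD; exact: ltW.
Qed.

Lemma content_rectangle_outer_open A B (e : R) : measurable A ->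
  measurable B -> 0 < e ->
  exists U V, [/\ open (U : set T1), open (V : set T2),
    A `<=` U, B `<=` V & (mu (U `*` V) <= mu (A `*` B) + e%:E)%E].
Proof.
move=> mA mB e0; have e20 : 0 < e / 2 by rewrite divr_gt0.
have [U [oU AU UA]] := measure_outer_open m1 tT1 mA e20.
have [V [oV BV VB]] := measure_outer_open m2 tT2 mB e20.
exists U, V; split=> //.
apply: le_trans (content_rectangle_le mA (borel_open oU) mB (borel_open oV)) _.
rewrite [e in e%:E](splitr e) EFinD.
by apply: leeD2l; apply: leeD; exact: ltW.
Qed.

Local Notation rT := (rect_type (borel T1) (borel T2)).

Definition rect_content (X : set rT) : \bar R := mu X.

Let rect_measurable (X : set rT) :
  measurable X -> measurable (X : set (borel T1 * borel T2)).
Proof. by move=> [A mA [B mB <-]]; exact: measurableX. Qed.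

Let rect_content_ge0 (X : set rT) : (0 <= rect_content X)%E.
Proof. exact: measure_ge0. Qed.

Let rect_content_semi_additive : measure_function.semi_additive rect_content.
Proof.
move=> F n mF tF mU; apply: measure_semi_additive => //.
  by move=> k; exact: rect_measurable.
exact: rect_measurable.
Qed.

(* Compact sets from inside and open sets from outside reduce a countable
   cover by rectangles to a finite one. *)
Let rect_content_sigma_subadditive :
  measurable_subset_sigma_subadditive rect_content.
Proof.
move=> X Y mY [A mA [B mB <-{X}]] XY; apply/lee_addgt0Pr => e e0.
have e20 : 0 < e / 2 by rewrite divr_gt0.
have [K [L [cK cL KA LB KL]]] := content_rectangle_inner_compact mA mB e20.
have /choice[UV UVP] n : exists UV : set T1 * set T2, [/\ open UV.1, open UV.2,
    Y n `<=` UV.1 `*` UV.2 &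
    (mu (UV.1 `*` UV.2) <= mu (Y n) + (e / 2 / (2 ^ n.+1)%:R)%:E)%E].
  have [C mC [D mD <-]] := mY n.
  have [|U [V [oU oV CU DV CD]]] := @content_rectangle_outer_open C D
    (e / 2 / (2 ^ n.+1)%:R) mC mD; first by rewrite !divr_gt0// ltr0n expn_gt0.
  by exists (U, V); split=> //; exact: setSX.
pose W n : set (borel T1 * borel T2) := (UV n).1 `*` (UV n).2.
have mW n : measurable (W n).
  by have [oU oV _ _] := UVP n; apply: measurableX; exact: borel_open.
have [|n||N KLW] := @compact_bigcup_open (T1 * T2)%type (K `*` L) W.
- exact: compact_setX.
- by have [oU oV _ _] := UVP n; exact: openX.
- move=> [x y] [/KA Ax /LB By]; have [n _ Yn] := XY (x, y) (conj Ax By).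
  by exists n => //; have [_ _ YUV _] := UVP n; exact: YUV.
apply: le_trans KL _; have -> : (e%:E = (e / 2)%:E + (e / 2)%:E)%E.
  by rewrite -EFinD -splitr.
rewrite addeA leeD2r//.
apply: (@le_trans _ _ (\sum_(i < N) mu (W i))%E).
  apply: content_subadditive => //; apply: measurableX.
    exact: borel_compact (tame_hausdorff tT1) cK.
  exact: borel_compact (tame_hausdorff tT2) cL.
apply: (@le_trans _ _ (\sum_(0 <= i <oo)
    (rect_content (Y i) + (e / 2 / (2 ^ i.+1)%:R)%:E))%E).
  apply: (@le_trans _ _ (\sum_(0 <= i < N)
      (rect_content (Y i) + (e / 2 / (2 ^ i.+1)%:R)%:E))%E).
    by rewrite big_mkord; apply: lee_sum => i _; have [] := UVP i.
  apply: nneseries_lim_ge => n _ _; apply: adde_ge0 => //.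
  by rewrite lee_fin !divr_ge0 ?ltW.
by apply: epsilon_trick => //; rewrite ltW.
Qed.

HB.instance Definition _ := isContent.Build _ _ _ rect_content
  rect_content_ge0 rect_content_semi_additive.

HB.instance Definition _ := Content_SigmaSubAdditive_isMeasure.Build _ _ _
  rect_content rect_content_sigma_subadditive.

Local Notation sigma_rectangles :=
  (g_sigma_algebraType (@rectangles _ _ (borel T1) (borel T2))).

Let measurable_rect_id :
  measurable_fun setT (id : sigma_rectangles -> borel (T1 * T2)%type).
Proof.
apply: (@measurability _ _ sigma_rectangles (borel (T1 * T2)%type) setT id
  (@open (T1 * T2)%type)) => //.
move=> _ [W oW <-]; rewrite setTI preimage_id.
have [B1 oB1 bB1] := second_countable_seq (tame_second_countable tT1).
have [B2 oB2 bB2] := second_countable_seq (tame_second_countable tT2).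
pose D (k : nat * nat) : set (T1 * T2) := B1 k.1 `*` B2 k.2.
have -> : W = \bigcup_k (if `[< D k `<=` W >] then D k else set0).
  apply/seteqP; split=> [[x y] Wxy|p [k _]]; last by case: asboolP => // DW /DW.
  move: oW; rewrite openE => /(_ _ Wxy)[[U V] /= [nU nV] UVW].
  move: nU nV; rewrite !nbhsE => -[U' [oU' U'x] U'U] [V' [oV' V'y] V'V].
  have [i B1x B1U] := bB1 _ _ oU' U'x; have [j B2y B2V] := bB2 _ _ oV' V'y.
  exists (i, j) => //; rewrite asboolT// => -[u v] [/= /B1U/U'U Uu /B2V/V'V Vv].
  exact: UVW.
apply: countable_bigcupT_measurable => // k; case: ifP => // _.
apply: sub_sigma_algebra; exists (B1 k.1); first exact: borel_open.
by exists (B2 k.2); first exact: borel_open.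
Qed.

Lemma rectangle_extension : exists P : probability (borel (T1 * T2)%type) R,
  forall A B, measurable A -> measurable B -> P (A `*` B) = mu (A `*` B).
Proof.
pose nu : {measure set sigma_rectangles -> \bar R} :=
  measure_extension rect_content.
have nuE A B : measurable A -> measurable B -> nu (A `*` B) = mu (A `*` B).
  move=> mA mB; rewrite /nu/= /measure_extension measurable_mu_extE//.
  by exists A => //; exists B.
have [|P PE] := @probability_of_measure _ _ R nu.
  by rewrite -setXTT nuE// mu_fst// probability_setT.
have [Q QE] := pushforward_probability P measurable_rect_id.
by exists Q => A B mA mB; rewrite QE /pushforward preimage_id PE nuE.
Qed.

End RectangleExtension.

Definition membership_code (T : Type) (B : nat -> set T) n (x : T) :
    {ffun 'I_n -> bool} :=
  [ffun i : 'I_n => `[< B i x >]].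

Lemma measurable_membership_code d (T : measurableType d) (B : nat -> set T) n c :
  (forall k, measurable (B k)) ->
  measurable (@membership_code T B n @^-1` [set c]).
Proof.
move=> mB.
rewrite (_ : _ @^-1` _ = \bigcap_(i : 'I_n) (if c i then B i else ~` B i)).
  apply: fin_bigcap_measurable => [|i _]; first exact: finite_finset.
  by case: ifP => _ //; exact: measurableC.
apply/seteqP; split=> [x <- i _|x xc]; first by rewrite ffunE; case: asboolP.
apply/ffunP => i; rewrite ffunE; have := xc i I.
by case: ifP => _ Bx; apply/asboolP.
Qed.

Lemma content_gluing (R : realType) (d1 d2 d : measure_display)
    (T1 : measurableType d1) (T2 : measurableType d2) (Q : measurableType d)
    (m1 : probability T1 R) (m2 : probability T2 R)
    (phi : T1 -> Q) (psi : T2 -> Q) (B : nat -> set Q) :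
  measurable_fun setT phi -> measurable_fun setT psi ->
  (forall k, measurable (B k)) ->
  (forall C, measurable C -> pushforward m1 phi C = pushforward m2 psi C) ->
  exists mu : {content set (T1 * T2)%type -> \bar R},
    [/\ forall X, measurable X -> mu (X `*` setT) = m1 X,
        forall Y, measurable Y -> mu (setT `*` Y) = m2 Y &
        forall k, mu (phi @^-1` B k `*` ~` (psi @^-1` B k)) = 0%E].
Proof.
move=> mphi mpsi mB phi_psi.
have /choice[p pP] n := @finite_gluing R _ _ {ffun 'I_n -> bool} _ _ m1 m2
  (@membership_code _ B n \o phi) (@membership_code _ B n \o psi)
  (fun c => measurable_preimage mphi (measurable_membership_code c mB))
  (fun c => measurable_preimage mpsi (measurable_membership_code c mB))
  (fun c => phi_psi _ (measurable_membership_code c mB)).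
have [F [FU ooF]] := @ultraFilterLemma nat \oo _.
have [mu muP] := ultralimit_content p FU.
have mu_eq X l : measurable X -> (\forall n \near F, p n X = l) -> mu X = l.
  move=> mX pX; apply: (@cvg_unique _ (@ereal_hausdorff R) _ _ _ _ (muP X mX)).
  exact: cvg_near_cst.
exists mu; split=> [X mX|Y mY|k].
- apply: mu_eq; first exact: measurableX.
  by apply: nearW => n; have [-> //] := pP n.
- apply: mu_eq; first exact: measurableX.
  by apply: nearW => n; have [_ -> //] := pP n.
have mphiB := measurable_preimage mphi (mB k).
have mpsiB := measurableC (measurable_preimage mpsi (mB k)).
apply: mu_eq; first exact: measurableX.
apply: ooF; exists k.+1 => // n /= kn; have [_ _ p0] := pP n; apply: p0 => //.
move=> x y Bx nBy /ffunP/(_ (Ordinal kn)); rewrite !ffunE/= => xy.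
by apply: nBy; apply/asboolP; rewrite -xy; exact/asboolP.
Qed.

Lemma gluing (R : realType) (T1 T2 Q : ptopologicalType)
    (m1 : probability (borel T1) R) (m2 : probability (borel T2) R)
    (phi : borel T1 -> borel Q) (psi : borel T2 -> borel Q) :
  tame_space T1 -> tame_space T2 -> hausdorff_space Q -> @second_countable Q ->
  measurable_fun setT phi -> measurable_fun setT psi ->
  (forall C, measurable C -> pushforward m1 phi C = pushforward m2 psi C) ->
  exists P : probability (borel (T1 * T2)%type) R,
    [/\ forall A : set (borel T1), measurable A -> P (A `*` setT) = m1 A,
        forall B : set (borel T2), measurable B -> P (setT `*` B) = m2 B &
        \forall p \ae P, phi p.1 = psi p.2].
Proof.
move=> tT1 tT2 hQ /second_countable_seq[B oB bB] mphi mpsi phi_psi.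
have mB k : measurable (B k : set (borel Q)) by exact: borel_open.
have [mu [mu1 mu2 mu0]] := content_gluing mphi mpsi mB phi_psi.
have [P PE] := rectangle_extension tT1 tT2 mu1 mu2.
exists P; split=> [A mA|C mC|]; rewrite ?PE ?mu1 ?mu2//.
have P0 k : P.-negligible ((phi @^-1` B k) `*` ~` (psi @^-1` B k)).
  have mphiB := measurable_preimage mphi (mB k).
  have mpsiB := measurableC (measurable_preimage mpsi (mB k)).
  by apply/negligibleP; [exact: borel_setX|rewrite -(mu0 k); exact: PE].
apply: negligibleS (negligible_bigcup P0) => -[x y] /= xy.
have [U [oU]] := hausdorff_accessible hQ (introN eqP xy).
rewrite !inE => Ux nUy; have [k Bx BU] := bB U _ oU Ux.
by exists k => //; split=> //= By; exact/nUy/BU.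
Qed.

(** * The distance quotient *)

Section QuotientMap.
Context (R : realType) (M : nblmms R).

Let tauP : is_blms (tsep M) := tsepP M.

(* Takes the junk value [point] off the support. *)
Definition qmap (x : tspace M) : qi0 M :=
  if pselect (x \in spt M) is left h
  then to_with_i0 (qtsep M) (qproj (exist _ x h)) else point.

Lemma spt_closed : closed (spt M).
Proof. exact: support_closed. Qed.

Lemma measurable_spt : measurable (spt M : set (borel (tspace M))).
Proof. exact: measurable_support. Qed.

Lemma meas_ae_spt : \forall x \ae meas M, spt M x.
Proof.
apply/negligibleP; first by apply: measurableC; exact: measurable_spt.
by apply: measure_setC_support; exact: tame_second_countable (blms_tame tauP).
Qed.

Lemma meas_setI_spt (A : set (borel (tspace M))) : measurable A ->
  meas M (spt M `&` A) = meas M A.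
Proof.
by apply: measure_setI_support; exact: tame_second_countable (blms_tame tauP).
Qed.

Lemma spt_proper : proper_on (spt M) (tsep M).
Proof. by apply: proper_on_closed spt_closed _; exact: blms_proper. Qed.

Lemma qmapE (x : spt M) : qmap (val x) = to_with_i0 (qtsep M) (qproj x).
Proof.
rewrite /qmap; case: pselect => [h|]; last by move=> []; exact: valP.
by congr (to_with_i0 _ (qproj _)); apply: val_inj.
Qed.

Lemma qmap_out (x : tspace M) : ~ spt M x -> qmap x = point.
Proof.
by move=> nx; rewrite /qmap; case: pselect => // xS; case: nx; exact: set_mem xS.
Qed.

Lemma qmap_tsep (x y : tspace M) : spt M x -> spt M y ->
  qi0_tsep M (qmap x) (qmap y) = tsep M x y.
Proof.
move=> /mem_set hx /mem_set hy.
rewrite (qmapE (exist _ x hx)) (qmapE (exist _ y hy)).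
by rewrite /qi0_tsep/tau_i0/= qtsepE.
Qed.

Lemma qprojP (a : dquot M) : exists x : spt M, qproj x = a.
Proof.
by exists (repr (a : {eq_quot (indist_equiv M)})); rewrite /qproj reprK.
Qed.

Lemma qmap_cover (a : qi0 M) :
  ~ is_spacelike_boundary (qi0_tsep M) a -> (qmap @` spt M) a.
Proof.
case: a => -[a|] ha nb; last first.
  by exfalso; apply: nb => c; rewrite /qi0_tsep/tau_i0/=; case: (val c).
have [x xa] := qprojP a; exists (val x); first exact: set_mem (valP x).
by rewrite qmapE; apply: val_inj => /=; rewrite xa.
Qed.

Lemma qi0_boundary : exists i : qi0 M, is_spacelike_boundary (qi0_tsep M) i.
Proof.
have [[i bi]|h] := pselect (exists i, is_spacelike_boundary (qtsep M) i).
  by exists (to_with_i0 (qtsep M) i) => -[[b|] hb]; rewrite /qi0_tsep/tau_i0/=.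
have hN : None \in [set o : option (dquot M) | o = None ->
    ~ (exists i, is_spacelike_boundary (qtsep M) i)] by rewrite inE.
by exists (exist _ None hN) => c; rewrite /qi0_tsep/tau_i0/=; case: (val c).
Qed.

Lemma qi0_pair_inj (a b : qi0 M) :
  (forall z, tau_pair (qi0_tsep M) z a = tau_pair (qi0_tsep M) z b) -> a = b.
Proof.
pose t := to_with_i0 (qtsep M).
have some_none c hc hn : ~ forall z,
    tau_pair (qi0_tsep M) z (exist _ (Some c) hc) =
    tau_pair (qi0_tsep M) z (exist _ None hn).
  move=> cn; apply: (set_mem hn erefl); exists c => d.
  by have [dc cd] := cn (t d); split; [exact: cd|exact: dc].
case: a b => -[a|] ha [[b|] hb] ab; last exact: val_inj.
- apply: val_inj => /=; congr Some.
  have [x xa] := qprojP a; have [y yb] := qprojP b.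
  rewrite -xa -yb; apply/(eqquotP {eq_quot (indist_equiv M)})/asboolP => z.
  have := ab (t (qproj z)); rewrite /tau_pair /qi0_tsep/tau_i0/=.
  by rewrite -xa -yb !qtsepE => -[-> ->].
- by case: (some_none _ _ _ ab).
- by case: (some_none _ _ _ (fun z => esym (ab z))).
Qed.

Lemma qi0_tsep_ge0 (a b : qi0 M) : 0 <= qi0_tsep M a b.
Proof.
rewrite /qi0_tsep/tau_i0; case: (val a) => // a'; case: (val b) => // b'.
exact: blms_ge0 tauP _ _.
Qed.

Lemma qi0_reverse_triangle (a b c : qi0 M) :
  0 < qi0_tsep M a b -> 0 < qi0_tsep M b c ->
  qi0_tsep M a b + qi0_tsep M b c <= qi0_tsep M a c.
Proof.
case: a b c => -[a|] ha [[b|] hb] [[c|] hc]; rewrite /qi0_tsep/tau_i0/= ?ltxx//.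
have [x <-] := qprojP a; have [y <-] := qprojP b; have [z <-] := qprojP c.
by rewrite !qtsepE; exact: blms_reverse_triangle tauP _ _ _.
Qed.

Lemma qi0_pair_separation (a b : qi0 M) : a <> b ->
  exists z, tau_pair (qi0_tsep M) z a <> tau_pair (qi0_tsep M) z b.
Proof.
move=> ab; apply: contrapT => /forallNP abE; apply: ab; apply: qi0_pair_inj => z.
exact: contrapT (abE z).
Qed.

Lemma qi0_blms : is_blms (qi0_tsep M).
Proof.
split.
- exact: qi0_tsep_ge0.
- exact: qi0_reverse_triangle.
- have [D _ tauD] := presentation_tau_topology spt_proper qmap_tsep qmap_cover
    qi0_tsep_ge0 qi0_pair_separation.
  by exists (family_topology D (tau_pair (qi0_tsep M))).
- move=> a b /qi0_pair_separation[z abz]; exists z.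
  apply: contrapT => /not_orP[/contrapT ab /contrapT za]; apply: abz.
  by rewrite /tau_pair ab za.
Qed.

Lemma qmap_continuous :
  {within spt M, continuous (qmap : tspace M -> qi0_space M)}.
Proof.
apply: (@presentation_continuous R (tspace M) (qi0_space M) (spt M) (tsep M)
  (qi0_tsep M) qmap setT).
- exact: spt_proper.
- exact: qmap_tsep.
- exact: qmap_cover.
- exact: blms_initial_family qi0_blms.
Qed.

Lemma measurable_qmap :
  measurable_fun setT (qmap : borel (tspace M) -> borel (qi0_space M)).
Proof.
rewrite -(setUv (spt M)); apply/measurable_funU.
- exact: measurable_spt.
- by apply: measurableC; exact: measurable_spt.
split; first exact: within_continuous_measurable qmap_continuous.
apply: (eq_measurable_fun (cst point)); last exact: measurable_cst.
by move=> x; rewrite inE => /qmap_out.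
Qed.

Lemma qi0_measE (A : set (borel (qi0_space M))) : measurable A ->
  qi0_meas M A = meas M (qmap @^-1` A).
Proof.
move=> mA; rewrite -meas_setI_spt; last first.
  exact: measurable_preimage measurable_qmap mA.
rewrite /qi0_meas; congr (meas M _).
apply/seteqP; split=> [_ [x Ax <-]|x [Sx Ax]].
  by split; [exact: set_mem (valP x)|rewrite /= qmapE].
by exists (exist _ x (mem_set Sx)) => //=; rewrite -qmapE.
Qed.

Lemma qi0_meas_gt0 (U : set (qi0_space M)) (a : qi0 M) : open U -> U a ->
  ~ is_spacelike_boundary (qi0_tsep M) a -> (0 < meas M (qmap @^-1` U))%E.
Proof.
move=> oU Ua /qmap_cover[x Sx xa].
have /open_subspaceP[V oV VU] : open (qmap @^-1` U : set (subspace (spt M))).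
  apply: (@open_comp (subspace (spt M)) (qi0_space M) qmap) => // y _.
  exact: qmap_continuous.
have [Vx _] : (V `&` spt M) x by rewrite VU; split=> //=; rewrite xa.
rewrite -meas_setI_spt; last first.
  exact: measurable_preimage measurable_qmap (borel_open oU).
by rewrite setIC -VU setIC meas_setI_spt; [exact: Sx|exact: borel_open].
Qed.

End QuotientMap.
Arguments qmap {R M} x.

(** * Distance-preserving correspondences *)

Section DenseOffBoundary.
Context (R : realType) (Y : pointedType) (tau : Y -> Y -> R).
Hypothesis tauP : is_blms tau.

Definition dense_off_boundary (A : set (lspace tau)) : Prop :=
  forall y, ~ is_spacelike_boundary tau y -> closure A y.

Lemma dense_off_boundary_separating (A : set (lspace tau)) (x y : lspace tau) :
  dense_off_boundary A ->
  (forall z, A z -> tau_pair tau z x = tau_pair tau z y) -> x = y.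
Proof.
move=> dA xy; apply: contrapT => /(blms_pair_separation tauP)[z]; apply.
have [bz|/dA Az] := pselect (is_spacelike_boundary tau z).
  by rewrite !(tau_pair_boundary _ bz).1.
apply: tau_pairC; apply: (@closure_continuous_eq (lspace tau) (R * R)%type
  (tau_pair tau x) (tau_pair tau y) A z) => //.
- exact: blms_section_continuous.
- exact: blms_section_continuous.
- by move=> c; rewrite inE => Ac; exact/tau_pairC/xy.
Qed.

Lemma dense_off_boundary_core_nbhs (A : set (lspace tau)) (y : lspace tau) :
  dense_off_boundary A -> ~ is_spacelike_boundary tau y ->
  exists2 e, 0 < e & nbhs y (timelike_core tau A e).
Proof.
move=> dA /(nonboundary_timelike (blms_ge0 tauP))[z nz yz].
have y_cont := blms_section_continuous tauP (z := y).
have /(dA z nz)[c [Ac yc]] : \forall w \near (z : lspace tau),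
    0 < tau y w \/ 0 < tau w y.
  exact: (near_timelike (F := nbhs (z : lspace tau)) (h := id) (y_cont z) yz).
by apply: timelike_core_nbhs Ac _ yc; exact: blms_section_continuous.
Qed.

Context (P : topologicalType) (S : set P) (s : P -> P -> R).
Context (h : P -> lspace tau).
Hypothesis s_proper : proper_on S s.
Hypothesis h_tau : forall p r, S p -> S r -> tau (h p) (h r) = s p r.

(* The points of [S] with image close to [y] stay in a timelike core, hence in
   a compact set; by separation, any of their cluster points is mapped to [y]. *)
Lemma dense_isometry_surj : dense_off_boundary (h @` S) ->
  forall y : lspace tau, ~ is_spacelike_boundary tau y -> (h @` S) y.
Proof.
move=> dS y ny.
pose F := filter_from (nbhs y) (fun U => S `&` h @^-1` U).
have FF : ProperFilter F.
  apply: filter_from_proper; last first.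
    by move=> U /(dS y ny)[_ [[p Sp <-] Up]]; exists p.
  apply: filter_from_filter => [|U V nU nV].
    by exists setT; exact: filterT.
  by exists (U `&` V); [exact: filterI|move=> p [Sp [Up Vp]]].
have [e e0 ye] := dense_off_boundary_core_nbhs dS ny.
have Fcore : F (S `&` timelike_core s S e).
  exists (timelike_core tau (h @` S) e) => // p [Sp [_ [r Sr <-]]].
  by rewrite !h_tau// => pr; split=> //; exists r.
have [p [[Sp _] Fp]] := proper_on_timelike_core_compact s_proper e0 FF Fcore.
exists p => //.
apply: dense_off_boundary_separating dS _ => _ [r Sr <-]; symmetry.
rewrite (tau_pair_image h_tau)//.
apply: cluster_cvg_eq Fp _ _.
- exact: hausdorff_prod (@Rhausdorff R) (@Rhausdorff R).
- move=> A /(blms_section_continuous tauP (x := y)) nA.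
  exists (tau_pair tau (h r) @^-1` A) => // q [Sq /=].
  by rewrite (tau_pair_image h_tau).
- exact: proper_on_section_continuous s_proper _.
Qed.

End DenseOffBoundary.

Section IsometryTransfer.
Context (R : realType) (Y Y' : pointedType).
Context (tau : Y -> Y -> R) (tau' : Y' -> Y' -> R).
Hypotheses (tauP : is_blms tau) (tauP' : is_blms tau').
Context (P : Type) (S : set P) (h : P -> lspace tau) (h' : P -> lspace tau').
Hypothesis h_surj : forall y, ~ is_spacelike_boundary tau y -> (h @` S) y.
Hypothesis h'_surj : forall y, ~ is_spacelike_boundary tau' y -> (h' @` S) y.
Hypothesis hh' : forall p r, S p -> S r -> tau (h p) (h r) = tau' (h' p) (h' r).
Hypothesis tau'_boundary : exists i, is_spacelike_boundary tau' i.

Let section_inj (a b : lspace tau') :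
  (forall r, S r -> tau_pair tau' (h' r) a = tau_pair tau' (h' r) b) -> a = b.
Proof.
move=> ab; apply: (dense_off_boundary_separating tauP' (A := h' @` S)).
  by move=> y /h'_surj; exact: subset_closure.
by move=> _ [r Sr <-]; exact: ab.
Qed.

Lemma isometry_transfer : exists iota : lspace tau -> lspace tau',
  [/\ distance_preserving tau tau' iota, continuous iota &
      forall p, S p -> iota (h p) = h' p].
Proof.
have [i bi] := tau'_boundary.
have pair_hh' p r : S p -> S r ->
    tau_pair tau' (h' p) (h' r) = tau_pair tau (h p) (h r).
  by move=> Sp Sr; rewrite /tau_pair !hh'.
have /choice[iota iotaP] (a : lspace tau) :
    exists b : lspace tau', forall r, S r ->
      tau_pair tau' (h' r) b = tau_pair tau (h r) a.
  have [ba|/h_surj[p Sp <-]] := pselect (is_spacelike_boundary tau a).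
    exists i => r _.
    by rewrite (tau_pair_boundary _ bi).2 (tau_pair_boundary _ ba).2.
  by exists (h' p) => r Sr; exact: pair_hh'.
have iota_h p : S p -> iota (h p) = h' p.
  by move=> Sp; apply: section_inj => r Sr; rewrite iotaP// pair_hh'.
have iota_boundary a : is_spacelike_boundary tau a -> iota a = i.
  move=> ba; apply: section_inj => r Sr; rewrite iotaP//.
  by rewrite (tau_pair_boundary _ bi).2 (tau_pair_boundary _ ba).2.
exists iota; split=> // [a b|a].
  have [ba|/h_surj[r Sr <-]] := pselect (is_spacelike_boundary tau a).
    by rewrite (iota_boundary a ba) (ba b).1 (bi _).1.
  by rewrite iota_h//; have [-> _] := iotaP b r Sr.
have nbhs_iota := fmap_filter iota (nbhs_filter (a : lspace tau)).
apply/(blms_initial_family tauP' _ nbhs_iota).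
move=> z _.
suff : tau_pair tau' z (iota b) @[b --> a] --> tau_pair tau' z (iota a) by [].
have [bz|/h'_surj[r Sr <-]] := pselect (is_spacelike_boundary tau' z).
  rewrite (tau_pair_boundary _ bz).1 (_ : (fun b => _) = cst 0).
    exact: (@cst_continuous (lspace tau) (R * R)%type).
  by apply/funext => b /=; rewrite (tau_pair_boundary _ bz).1.
rewrite iotaP// (_ : (fun b => _) = tau_pair tau (h r)).
  exact: blms_section_continuous.
by apply/funext => b; rewrite iotaP.
Qed.

End IsometryTransfer.

(** * Isomorphy *)

Section Correspondence.
Context (R : realType) (P : ptopologicalType) (rho : probability (borel P) R).
Context (S : set P) (s : P -> P -> R).
Hypothesis s_proper : proper_on S s.
Hypothesis rho_S : forall A : set (borel P),
  measurable A -> rho (S `&` A) = rho A.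

Record measure_isometry_on (M : nblmms R)
    (h : borel P -> borel (qi0_space M)) : Prop := MeasureIsometryOn {
    measure_isometry_tsep :
      forall p r, S p -> S r -> qi0_tsep M (h p) (h r) = s p r;
    measure_isometry_measurable : measurable_fun setT h;
    measure_isometry_pushforward : forall A, measurable A ->
      pushforward rho h A = qi0_meas M A }.

Lemma measure_isometry_surj (M : nblmms R) (h : borel P -> borel (qi0_space M)) :
  measure_isometry_on h ->
  forall a, ~ is_spacelike_boundary (qi0_tsep M) a -> (h @` S) a.
Proof.
move=> [h_tau mh hrho].
apply: (dense_isometry_surj (qi0_blms M) s_proper h_tau) => a na U.
rewrite nbhsE => -[V [oV Va] VU]; have mV := borel_open oV.
suff [p [Sp Vp]] : S `&` h @^-1` V !=set0.
  by exists (h p); split; [exists p|exact: VU].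
apply/set0P/eqP => V0; have := qi0_meas_gt0 oV Va na.
rewrite -qi0_measE// -hrho// /pushforward -rho_S; last first.
  exact: measurable_preimage mh mV.
by rewrite V0 measure0 ltxx.
Qed.

Lemma correspondence_isomorphic (M M' : nblmms R)
    (h : borel P -> borel (qi0_space M)) (h' : borel P -> borel (qi0_space M')) :
  measure_isometry_on h -> measure_isometry_on h' -> isomorphic M M'.
Proof.
move=> hP hP'; have [h_tau mh hrho] := hP; have [h'_tau mh' h'rho] := hP'.
have [||iota [iota_tau iota_cont iota_h]] := isometry_transfer (qi0_blms M)
  (qi0_blms M') (measure_isometry_surj hP) (measure_isometry_surj hP').
- by move=> p r Sp Sr; rewrite h_tau// h'_tau.
- exact: qi0_boundary.
have miota : measurable_fun setT
    (iota : borel (qi0_space M) -> borel (qi0_space M')).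
  exact: continuous_measurable.
exists iota; split=> // A mA; have miotaA := measurable_preimage miota mA.
rewrite -h'rho// /pushforward -hrho// /pushforward.
rewrite -rho_S; last exact: measurable_preimage mh miotaA.
rewrite -[RHS]rho_S; last exact: measurable_preimage mh' mA.
congr (rho _); apply/seteqP.
by split=> p [Sp Ap]; split=> //; move: Ap; rewrite /= iota_h.
Qed.

End Correspondence.

Lemma measure_isometry_onT (R : realType) (P : ptopologicalType)
    (rho : probability (borel P) R) (s : P -> P -> R) (M : nblmms R)
    (h : borel P -> borel (qi0_space M)) :
  measure_isometry_on rho setT s h <->
  [/\ distance_preserving s (qi0_tsep M) h, measurable_fun setT h &
      forall A, measurable A -> pushforward rho h A = qi0_meas M A].
Proof.
split=> -[h_tau mh hrho]; split=> //; first by move=> p r; rewrite h_tau.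
Qed.

Lemma common_extension_isomorphic (R : realType) (M M' Mh : nblmms R)
    (iotah : borel (tspace Mh) -> borel (qi0_space M))
    (iotah' : borel (tspace Mh) -> borel (qi0_space M')) :
  measure_isometry_on (meas Mh) setT (tsep Mh) iotah ->
  measure_isometry_on (meas Mh) setT (tsep Mh) iotah' ->
  isomorphic M M'.
Proof.
apply: correspondence_isomorphic => [|A mA]; last by rewrite setTI.
exact: blms_proper (tsepP Mh).
Qed.

Lemma proper_on_prod (R : realType) (P P' : topologicalType) (S : set (P * P'))
    (s : P -> P -> R) (s' : P' -> P' -> R) :
  closed S -> proper_on setT s -> proper_on setT s' ->
  (forall p r, S p -> S r -> s p.1 r.1 = s' p.2 r.2) ->
  proper_on S (fun p r => s p.1 r.1).
Proof.
move=> cS [s_cont s_compact] [_ s'_compact] ss'; split=> [|e e0].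
  exact: continuous_interchange_fst s_cont.
pose K := [set q : P * P | e <= s q.1 q.2].
pose K' := [set q : P' * P' | e <= s' q.1 q.2].
rewrite (_ : _ `&` _ = (@interchange _ _ _ _) @` (K `*` K') `&` (S `*` S)).
  apply: compact_closedI; last exact: closedX.
  apply: continuous_compact.
    by apply: continuous_subspaceT => q; exact: interchange_continuous.
  have := compact_setX (s_compact e e0) (s'_compact e e0).
  by rewrite !setXTT !setTI.
apply/seteqP.
split=> [[p r] [[/= Sp Sr] epr]|_ [[[q q'] [/= eq _] <-] [Sp Sr]]] //.
split=> //; exists (interchange (p, r)); first by split; rewrite /K/K'/= -?ss'.
by rewrite /interchange/= -!surjective_pairing.
Qed.

Lemma support_pushforward (R : realType) (T U : ptopologicalType)
    (m : {measure set (borel T) -> \bar R})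
    (m' : {measure set (borel U) -> \bar R}) (f : T -> U) (x : T) :
  continuous f ->
  (forall A, measurable A -> pushforward m (f : borel T -> borel U) A = m' A) ->
  support m x -> support m' (f x).
Proof.
move=> cf fm mx V oV Vfx; rewrite -fm; last exact: borel_open.
by apply: mx => //; apply: open_comp => // y _; exact: cf.
Qed.

Section Coupling.
Context (R : realType) (M M' : nblmms R).
Context (pi : probability (borel (tspace M * tspace M')%type) R).
Hypothesis pi_coupling : is_coupling pi.

Let fst_spt p : support pi p -> spt M p.1.
Proof.
apply: (@support_pushforward R (tspace M * tspace M')%type _ pi (meas M) fst).
  by move=> q; exact: cvg_fst.
exact: pi_coupling.1.
Qed.

Let snd_spt p : support pi p -> spt M' p.2.
Proof.
apply: (@support_pushforward R (tspace M * tspace M')%type _ pi (meas M') snd).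
  by move=> q; exact: cvg_snd.
exact: pi_coupling.2.
Qed.

Lemma coupling_ae_fst : \forall p \ae pi, spt M p.1.
Proof.
apply: (@ae_pushforward _ _ (borel (tspace M * tspace M')%type)
  (borel (tspace M)) R pi (meas M) fst (spt M)).
- exact: measurable_fst_borel.
- exact: pi_coupling.1.
- exact: meas_ae_spt.
Qed.

Lemma coupling_ae_snd : \forall p \ae pi, spt M' p.2.
Proof.
apply: (@ae_pushforward _ _ (borel (tspace M * tspace M')%type)
  (borel (tspace M')) R pi (meas M') snd (spt M')).
- exact: measurable_snd_borel.
- exact: pi_coupling.2.
- exact: meas_ae_spt.
Qed.

Lemma coupling_support_tsep :
  (\forall p \ae (pi \x pi)%E, tsep M p.1.1 p.2.1 = tsep M' p.1.2 p.2.2) ->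
  forall p r, support pi p -> support pi r -> tsep M p.1 r.1 = tsep M' p.2 r.2.
Proof.
move=> ae_tsep p r; apply: (@ae_eq_continuous_support _ _ _ _ pi pi
  (fun q => tsep M q.1.1 q.2.1) (fun q => tsep M' q.1.2 q.2.2)) => //.
- exact: continuous_interchange_fst (blms_proper (tsepP M)).1.
- exact: continuous_interchange_snd (blms_proper (tsepP M')).1.
Qed.

Lemma coupling_isomorphic :
  (\forall p \ae (pi \x pi)%E, tsep M p.1.1 p.2.1 = tsep M' p.1.2 p.2.2) ->
  isomorphic M M'.
Proof.
move=> /coupling_support_tsep support_tsep; have [pi1 pi2] := pi_coupling.
have s_proper : proper_on (support pi) (fun p r => tsep M p.1 r.1).
  apply: (@proper_on_prod R (tspace M) (tspace M') _ (tsep M) (tsep M')) => //.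
  - exact: support_closed.
  - exact: blms_proper (tsepP M).
  - exact: blms_proper (tsepP M').
have scTT : @second_countable (tspace M * tspace M')%type.
  by apply: second_countable_prod; apply: tame_second_countable;
    apply: blms_tame; exact: tsepP.
apply: (@correspondence_isomorphic R _ pi (support pi) _ s_proper
  (fun A mA => measure_setI_support pi scTT mA) M M'
  (qmap \o fst) (qmap \o snd)).
- split=> [p r Sp Sr||A mA].
  + by rewrite /= qmap_tsep//; exact: fst_spt.
  + exact: measurableT_comp (@measurable_qmap _ M) (@measurable_fst_borel _ _).
  + rewrite qi0_measE// -pi1//.
    exact: measurable_preimage (@measurable_qmap _ M) mA.
- split=> [p r Sp Sr||A mA].
  + by rewrite /= qmap_tsep ?support_tsep//; exact: snd_spt.
  + exact: measurableT_comp (@measurable_qmap _ M') (@measurable_snd_borel _ _).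
  + rewrite qi0_measE// -pi2//.
    exact: measurable_preimage (@measurable_qmap _ M') mA.
Qed.

End Coupling.

Section Isomorphic.
Context (R : realType) (M M' : nblmms R).
Context (iota : borel (qi0_space M) -> borel (qi0_space M')).
Hypothesis iota_tsep : distance_preserving (qi0_tsep M) (qi0_tsep M') iota.
Hypothesis miota : measurable_fun setT iota.
Hypothesis iota_pushforward : forall A, measurable A ->
  pushforward (qi0_meas M) iota A = qi0_meas M' A.

Lemma isomorphism_coupling :
  exists2 pi : probability (borel (tspace M * tspace M')%type) R, is_coupling pi &
    \forall p \ae (pi \x pi)%E, tsep M p.1.1 p.2.1 = tsep M' p.1.2 p.2.2.
Proof.
have tQ : tame_space (qi0_space M') := blms_tame (qi0_blms M').
have [|A mA|pi [pi1 pi2 ae_pi]] := gluing (m1 := meas M) (m2 := meas M')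
  (phi := iota \o qmap) (psi := qmap)
  (blms_tame (tsepP M)) (blms_tame (tsepP M'))
  (tame_hausdorff tQ) (tame_second_countable tQ) _ (@measurable_qmap _ M').
- exact: measurableT_comp miota (@measurable_qmap _ M).
- have := iota_pushforward mA; rewrite /pushforward !qi0_measE//.
  exact: measurable_preimage miota mA.
have pi_coupling : is_coupling pi.
  split=> A mA; rewrite /pushforward.
    by rewrite -setXT; exact: pi1.
  by rewrite -setTX; exact: pi2.
exists pi => //.
pose good p := [/\ spt M p.1, spt M' p.2 & iota (qmap p.1) = qmap p.2].
have ae_good : \forall p \ae pi, good p.
  have ae_filter := ae_filter_ringOfSetsType pi.
  apply: filterS3 (coupling_ae_fst pi_coupling)
    (coupling_ae_snd pi_coupling) ae_pi.
  by move=> p Sp Sp' ep; split.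
have ae_filter := ae_filter_ringOfSetsType (pi \x pi)%E.
apply: filterS2 (ae_prod_fst pi ae_good) (ae_prod_snd pi ae_good).
move=> [p r] /= [Sp Sp' ep] [Sr Sr' er].
by rewrite -(qmap_tsep Sp Sr) iota_tsep ep er qmap_tsep.
Qed.

Lemma isomorphism_common_extension :
  exists (Mh : nblmms R) (ih : Mh)
         (iotah : borel (tspace Mh) -> borel (qi0_space M))
         (iotah' : borel (tspace Mh) -> borel (qi0_space M')),
    [/\ is_spacelike_boundary (tsep Mh) ih,
        spt Mh `|` [set ih] = setT,
        measure_isometry_on (meas Mh) setT (tsep Mh) iotah &
        measure_isometry_on (meas Mh) setT (tsep Mh) iotah'].
Proof.
have [P PE] := pushforward_probability (meas M) (@measurable_qmap _ M).
have {}PE A : measurable A -> P A = qi0_meas M A.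
  by move=> mA; rewrite PE qi0_measE.
have [i bi] := qi0_boundary M.
exists (NBLMMS (qi0_blms M) P), i, id, iota; split=> //.
- apply/seteqP; split=> // a _.
  have [ba|na] := pselect (is_spacelike_boundary (qi0_tsep M) a).
    by right; exact: (blms_boundary_unique (qi0_blms M)).
  left=> U oU Ua; rewrite /= PE ?qi0_measE; [|exact: borel_open..].
  exact: qi0_meas_gt0 na.
- split=> // [p r _ _|A mA]; first by rewrite -iota_tsep.
  rewrite -iota_pushforward// /pushforward -PE//.
  exact: measurable_preimage miota mA.
Qed.

End Isomorphic.

Theorem lemma2p20 (R : realType) (M M' : nblmms R) :
  [<-> isomorphic M M';
       exists2 pi : probability (borel (tspace M * tspace M')%type) R,
         is_coupling pi &
         \forall p \ae (pi \x pi)%E, tsep M p.1.1 p.2.1 = tsep M' p.1.2 p.2.2;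
       exists (Mh : nblmms R) (ih : Mh)
              (iotah : borel (tspace Mh) -> borel (qi0_space M))
              (iotah' : borel (tspace Mh) -> borel (qi0_space M')),
         [/\ is_spacelike_boundary (tsep Mh) ih,
             spt Mh `|` [set ih] = setT,
             [/\ distance_preserving (tsep Mh) (qi0_tsep M) iotah,
                 measurable_fun setT iotah &
                 forall A, measurable A ->
                   pushforward (meas Mh) iotah A = qi0_meas M A] &
             [/\ distance_preserving (tsep Mh) (qi0_tsep M') iotah',
                 measurable_fun setT iotah' &
                 forall A, measurable A ->
                   pushforward (meas Mh) iotah' A = qi0_meas M' A]]].
Proof.
tfae.
- move=> [iota [iota_tsep miota iota_rho]].
  exact: isomorphism_coupling iota_rho.
- move=> [pi pi_coupling /(coupling_isomorphic pi_coupling)].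
  move=> [iota [iota_tsep miota iota_rho]].
  have [Mh [ih [h [h' [bih sptMh hP h'P]]]]] :=
    isomorphism_common_extension iota_tsep miota iota_rho.
  move: hP h'P => /measure_isometry_onT hP /measure_isometry_onT h'P.
  by exists Mh, ih, h, h'.
- move=> [Mh [ih [h [h' [_ _ hP h'P]]]]].
  by apply: (common_extension_isomorphic (iotah := h) (iotah' := h'));
    apply/measure_isometry_onT.
Qed.
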